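(* Let $\mathcal{M}$ be $\omega$-categorical and $MS$-measurable with dimension-measure $(\mathrm{d},\mu)$. Let $\overline{a},\overline{b},\overline{c}$ be finite tuples from $M$. Let $\mathrm{tp}(\overline{c}_1/\overline{a}\overline{b}),\dots,\mathrm{tp}(\overline{c}_n/\overline{a}\overline{b})$ be the finitely many complete non-forking extensions of $\mathrm{tp}(\overline{c}/\overline{a})$ to $\overline{a}\overline{b}$. Then $$\frac{\mu(\overline{a}\overline{c})\,\mu(\overline{a}\overline{b})}{\mu(\overline{a})}=\sum_{i=1}^n\mu(\overline{a}\overline{b}\overline{c}_i).$$
   Context: For a structure $\mathcal{M}$, $\mathrm{Def}(M)$ is the set of non-empty subsets of the powers $M^n$ ($n\ge 1$) definable with parameters. $\mathcal{M}$ is $MS$-measurable with dimension-measure $h:\mathrm{Def}(M)\to\mathbb{N}\times\mathbb{R}^{>0}$, $h(X)=(\mathrm{d}(X),\mu(X))$, if: (1) for each formula $\phi(\overline{x},\overline{y})$, $h(\phi(M^{|\overline{x}|},\overline{a}))$ takes finitely many values as $\overline{a}$ varies, and for each value $v$ the set of $\overline{a}$ with $h(\phi(M^{|\overline{x}|},\overline{a}))=v$ is $\emptyset$-definable; (2) $h(\{\overline{a}\})=(0,1)$ for every $\overline{a}\in M^n$; (3) for disjoint definable $X,Y\subseteq M^n$, $\mu(X\cup Y)=\mu(X)+\mu(Y)$ if $\mathrm{d}(X)=\mathrm{d}(Y)$, and $\mu(X\cup Y)=\mu(Y)$ if $\mathrm{d}(X)<\mathrm{d}(Y)$ [$\mathrm{d}$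 being a dimension, $\mathrm{d}(X\cup Y)=\max\{\mathrm{d}(X),\mathrm{d}(Y)\}$]; (4) (Fubini) if $X\subseteq M^n$ is definable, $\pi:M^n\to M^m$ ($1\le m<n$) is a projection to $m$ coordinates, and $h(\pi^{-1}(\overline{a})\cap X)=(k,\nu)$ for all $\overline{a}\in\pi(X)$, then $\mathrm{d}(X)=\mathrm{d}(\pi(X))+k$ and $\mu(X)=\mu(\pi(X))\nu$. $MS$-measurable structures are supersimple. For a finite tuple $\overline{a}$, $\mu(\overline{a})$ denotes the measure of the set defined by a formula isolating $\mathrm{tp}(\overline{a}/\emptyset)$, with the convention $\mu(\emptyset)=1$ for the empty tuple. *)

(* Defs.v *)
From HB Require Import structures.
From mathcomp Require Import all_boot all_order all_algebra.
From mathcomp Require Import boolp classical_sets functions cardinality reals.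
Set Implicit Arguments.
Unset Strict Implicit.
Unset Printing Implicit Defensive.
Import Order.TTheory GRing.Theory Num.Theory.
Local Open Scope classical_set_scope.
Local Open Scope ring_scope.

(* Languages are countable, as usual when speaking of omega-categoricity:
   otherwise the existence of isolating formulas can fail. *)
Record language := Language {
  fsym : countType;
  farity : fsym -> nat;
  rsym : countType;
  rarity : rsym -> nat }.

Record structure (L : language) := Structure {
  carrier :> Type;
  finterp : forall s : fsym L, (farity s).-tuple carrier -> carrier;
  rinterp : forall s : rsym L, (rarity s).-tuple carrier -> Prop }.

(* [formula L n] has its free variables among 'I_n; in the scope of [FAll]
   the bound variable is variable 0 and the other ones are shifted by one.
   The remaining connectives are defined classically from these. *)
Inductive term (L : language) (n : nat) : Type :=
| TVar of 'I_n
| TApp (s : fsym L) of ('I_(farity s) -> term L n).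

Inductive formula (L : language) : nat -> Type :=
| FFalse n : formula L n
| FEq n of term L n & term L n : formula L n
| FRel n (s : rsym L) of ('I_(rarity s) -> term L n) : formula L n
| FImp n of formula L n & formula L n : formula L n
| FAll n of formula L n.+1 : formula L n.
Arguments FFalse {L n}.

HB.instance Definition _ L n := gen_eqMixin (formula L n).
HB.instance Definition _ L n := gen_choiceMixin (formula L n).

Definition FNot (L : language) n (phi : formula L n) : formula L n :=
  FImp phi FFalse.

Fixpoint teval (L : language) (M : structure L) n (v : n.-tuple M)
    (t : term L n) : M :=
  match t with
  | TVar i => tnth v i
  | TApp s ts => finterp [tuple teval v (ts i) | i < farity s]
  end.

Fixpoint sat (L : language) (M : structure L) n (phi : formula L n) :
    n.-tuple M -> Prop :=
  match phi in formula _ n return n.-tuple M -> Prop with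
  | FFalse _ => fun=> False
  | FEq _ t u => fun v => teval v t = teval v u
  | FRel _ s ts => fun v => rinterp [tuple teval v (ts i) | i < rarity s]
  | FImp _ phi1 phi2 => fun v => sat phi1 v -> sat phi2 v
  | FAll _ phi1 => fun v => forall x : M, sat phi1 [tuple of x :: v]
  end.

Section Maps.
Variables (L : language) (M N : structure L).

Definition elementary_embedding (f : M -> N) : Prop :=
  forall n (phi : formula L n) (v : n.-tuple M),
    sat phi v <-> sat phi (map_tuple f v).

Definition elementarily_equivalent : Prop :=
  forall phi : formula L 0, sat phi ([tuple] : 0.-tuple M) <->
                            sat phi ([tuple] : 0.-tuple N).

Definition isomorphic : Prop :=
  exists f : M -> N, [/\ bijective f,
    forall (s : fsym L) (v : (farity s).-tuple M),
      f (finterp v) = finterp (map_tuple f v) &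
    forall (s : rsym L) (v : (rarity s).-tuple M),
      rinterp v <-> rinterp (map_tuple f v)].

End Maps.

Definition countably_infinite (T : Type) : Prop :=
  ([set: T] #= [set: nat])%card.

(* Th(M) has, up to isomorphism, exactly one countably infinite model. *)
Definition omega_categorical (L : language) (M : structure L) : Prop :=
  exists N : structure L,
    [/\ countably_infinite N, elementarily_equivalent M N &
      forall N' : structure L, countably_infinite N' ->
        elementarily_equivalent M N' -> isomorphic N N'].

(* Formulas phi(x, d) in m variables x, with a finite tuple d of parameters. *)
Record pformula (L : language) (M : structure L) (m : nat) := PFormula {
  plen : nat;
  pform : formula L (m + plen);
  ppar : plen.-tuple M }.

Section Types.
Variable L : language.
Implicit Types M N : structure L.

Definition entries (T : Type) n (v : n.-tuple T) : set T := range (tnth v).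

Definition psat M m (phi : pformula M m) (x : m.-tuple M) : Prop :=
  sat (pform phi) [tuple of x ++ ppar phi].

Definition pover M m (A : set M) (phi : pformula M m) : Prop :=
  entries (ppar phi) `<=` A.

Definition pnot M m (phi : pformula M m) : pformula M m :=
  PFormula (FNot (pform phi)) (ppar phi).

Definition pmap M N (f : M -> N) m (phi : pformula M m) : pformula N m :=
  PFormula (pform phi) (map_tuple f (ppar phi)).

Definition tp M m (x : m.-tuple M) (A : set M) : set (pformula M m) :=
  [set phi | pover A phi /\ psat phi x].

(* Complete types need not be realised in M. *)
Definition complete_type M m (A : set M) (p : set (pformula M m)) : Prop :=
  [/\ forall phi, p phi -> pover A phi,
      forall k (psi : 'I_k -> pformula M m), (forall i, p (psi i)) ->
        exists x : m.-tuple M, forall i, psat (psi i) x &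
      forall phi, pover A phi -> p phi \/ p (pnot phi)].

(* phi(x, d) divides over A, witnessed in N: there are k and a sequence
   (d_i) of realisations of tp(d/A) in N such that {phi(x, d_i)} is
   k-inconsistent. *)
Definition divides N m (phi : pformula N m) (A : set N) : Prop :=
  exists (k : nat) (d : nat -> (plen phi).-tuple N),
    (forall i, tp (d i) A = tp (ppar phi) A) /\
    (forall s : seq nat, uniq s -> size s = k ->
       ~ exists x : m.-tuple N,
           forall i, i \in s -> sat (pform phi) [tuple of x ++ d i]).

(* p implies a finite disjunction of formulas each of which divides over A.
   The elementary extension N plays the role of the monster model: it contains
   the parameters of the formulas and the sequences witnessing dividing. *)
Definition forks M m (p : set (pformula M m)) (A : set M) : Prop :=
  exists (N : structure L) (f : M -> N), elementary_embedding f /\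
  exists (k : nat) (phi : 'I_k -> pformula N m),
    (forall i, divides (phi i) (f @` A)) /\
  exists (j : nat) (psi : 'I_j -> pformula M m),
    (forall i, p (psi i)) /\
    (forall x : m.-tuple N,
       (forall i, psat (pmap f (psi i)) x) -> exists i, psat (phi i) x).

Definition nonforking_extension M m (p q : set (pformula M m)) (A B : set M) :
    Prop :=
  [/\ complete_type B q, p `<=` q & ~ forks q A].

(* tp(c_0/B), ..., tp(c_(n-1)/B) lists, without repetition, the complete
   non-forking extensions of tp(c/A) to B. *)
Definition lists_nonforking_extensions M m (c : m.-tuple M) (A B : set M)
    n (cs : 'I_n -> m.-tuple M) : Prop :=
  injective (fun i => tp (cs i) B) /\
  (forall q : set (pformula M m),
     nonforking_extension (tp c A) q A B <-> exists i, q = tp (cs i) B).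

(* phi isolates tp(x) over the empty set. *)
Definition isolates M m (x : m.-tuple M) (phi : formula L m) : Prop :=
  sat phi x /\
  (forall psi : formula L m, sat psi x ->
     forall y : m.-tuple M, sat phi y -> sat psi y).

End Types.

Section Measurable.
Variables (R : realType) (L : language) (M : structure L).

(* Elements of Def(M) in M^n, for n >= 1. *)
Definition in_Def n (X : set (n.-tuple M)) : Prop :=
  [/\ (0 < n)%N, X !=set0 & exists phi : pformula M n, X = psat phi].

Definition fiber n m (phi : formula L (n + m)) (a : m.-tuple M) :
    set (n.-tuple M) := [set x : n.-tuple M | sat phi [tuple of x ++ a]].

Definition proj n m (s : 'I_m -> 'I_n) (x : n.-tuple M) : m.-tuple M :=
  [tuple tnth x (s i) | i < m].

(* Only the values of a dimension-measure on Def(M) are meaningful. *)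
Definition dim_measure := forall n, set (n.-tuple M) -> nat * R.

Variable h : dim_measure.

Definition dm_dim n (X : set (n.-tuple M)) : nat := (h X).1.
Definition dm_mu n (X : set (n.-tuple M)) : R := (h X).2.

Record ms_measurable : Prop := MSMeasurable {
  ms_pos : forall n (X : set (n.-tuple M)), in_Def X -> 0 < dm_mu X;
  ms_finite : forall n m (phi : formula L (n + m)), (0 < n)%N ->
    finite_set [set h (fiber phi a) | a in [set a | fiber phi a !=set0]];
  ms_definable : forall n m (phi : formula L (n + m)) (v : nat * R),
    (0 < n)%N ->
    exists psi : formula L m, forall a : m.-tuple M,
      sat psi a <-> fiber phi a !=set0 /\ h (fiber phi a) = v;
  ms_point : forall n (a : n.-tuple M), (0 < n)%N -> h [set a] = (0%N, 1);
  ms_dimU : forall n (X Y : set (n.-tuple M)), in_Def X -> in_Def Y ->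
    dm_dim (X `|` Y) = maxn (dm_dim X) (dm_dim Y);
  ms_muU_eq : forall n (X Y : set (n.-tuple M)), in_Def X -> in_Def Y ->
    X `&` Y = set0 -> dm_dim X = dm_dim Y ->
    dm_mu (X `|` Y) = dm_mu X + dm_mu Y;
  ms_muU_lt : forall n (X Y : set (n.-tuple M)), in_Def X -> in_Def Y ->
    X `&` Y = set0 -> (dm_dim X < dm_dim Y)%N ->
    dm_mu (X `|` Y) = dm_mu Y;
  ms_fubini : forall n m (s : 'I_m -> 'I_n) (X : set (n.-tuple M))
      (k : nat) (nu : R),
    (1 <= m < n)%N -> injective s -> in_Def X ->
    (forall a, (proj s @` X) a -> h ((proj s @^-1` [set a]) `&` X) = (k, nu)) ->
    dm_dim X = (dm_dim (proj s @` X) + k)%N /\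
    dm_mu X = dm_mu (proj s @` X) * nu }.

(* In an omega-categorical structure isolating formulas exist, and they all
   define the same set, so the default and the choice are irrelevant. *)
Definition tuple_mu m (x : m.-tuple M) : R :=
  if (m == 0)%N then 1 else dm_mu (sat (xget FFalse (isolates x)) : set _).

End Measurable.

(* Main.v *)
(** By Ryll-Nardzewski, [M] has finitely many [n]-types for each [n]; this is
derived from the uniqueness of the countable model with a Henkin construction that
can either realise a filter of definable sets or omit a non-isolated type.
Definable sets are then the sets invariant under partial elementary maps
fixing a finite tuple.

A type [tp(c'/ab)] extending [tp(c/a)] does not fork over [a] iff it has
the same dimension [d]. If [d] drops, then by additivity [d(b/ac')] < [d(b/a)],
and in a sequence of copies of [b] which are [d]-independent over [a]
at most [d(c/a)] terms can have the same type over [ac'] as [b]: the formula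
isolating [tp(c'/ab)] divides over [a]. If [d] does not drop but the type
forks, some dividing formula cuts out of [tp(c/a)] a set of full dimension, and
arbitrarily many conjugates of equal measure have intersections of size [k]
that are empty, which contradicts finite additivity of the measure.

Hence [mu(c/a)] is the sum of the [mu(c_i/ab)], the types of smaller dimension
being negligible, and Fubini turns this into the claim. *)

Require Import Defs.
From mathcomp Require Import all_boot all_order all_algebra.
From mathcomp Require Import boolp classical_sets functions cardinality reals.
From Stdlib Require List.
Set Implicit Arguments.
Unset Strict Implicit.
Unset Printing Implicit Defensive.
Import Order.TTheory GRing.Theory Num.Theory.
Local Open Scope classical_set_scope.
Local Open Scope ring_scope.

(** * Formulas *)


(** The carrier of [M] may be uncountable, so automorphisms cannot be relied on to move tuples;
    finite partial elementary maps with the back-and-forth property, a consequence of the finiteness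
    of the number of types, replace them. Forking is tested in an arbitrary elementary extension
    [N], on which no measure is given. When forking is assumed, only finitely many parameters of [N]
    matter; they have copies in [M] over the given tuples, and [h] is only applied there. When
    forking is to be proved, [N = M] suffices, because [M] already contains the independent
    sequence.

    In the Henkin construction the points of the countable model are the variables themselves rather
    than classes of terms: conditions only admit injective valuations, so no quotient is taken and
    the model is infinite by construction. The price is that types are first counted for tuples with
    distinct entries; an arbitrary tuple is such a tuple together with a pattern of repetitions. *)

Section FormulaOperations.
Variable L : language.

Fixpoint trename n m (s : 'I_n -> 'I_m) (t : term L n) : term L m :=
  match t with
  | TVar i => TVar L (s i)
  | TApp f ts => TApp (fun i => trename s (ts i))
  end.

Definition slift n m (s : 'I_n -> 'I_m) (i : 'I_n.+1) : 'I_m.+1 :=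
  if unlift ord0 i is Some j then lift ord0 (s j) else ord0.

Fixpoint frename n (phi : formula L n) : forall m, ('I_n -> 'I_m) -> formula L m :=
  match phi in formula _ n return forall m, ('I_n -> 'I_m) -> formula L m with
  | FFalse _ => fun _ _ => FFalse
  | FEq _ t u => fun _ s => FEq (trename s t) (trename s u)
  | FRel _ r ts => fun _ s => FRel (fun i => trename s (ts i))
  | FImp _ phi1 phi2 => fun _ s => FImp (frename phi1 s) (frename phi2 s)
  | FAll _ phi1 => fun _ s => FAll (frename phi1 (slift s))
  end.

Definition FAnd n (phi psi : formula L n) := FNot (FImp phi (FNot psi)).
Definition FEx n (phi : formula L n.+1) := FNot (FAll (FNot phi)).

Fixpoint FExs k m : formula L (k + m) -> formula L m :=
  match k return formula L (k + m) -> formula L m with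
  | 0 => id
  | k'.+1 => fun phi => FExs (FEx phi)
  end.

Definition FBigAnd (I : finType) n (phi : I -> formula L n) :=
  foldr (fun i psi => FAnd (phi i) psi) (FNot FFalse) (enum I).

Variable M : structure L.

Lemma projE n m (s : 'I_m -> 'I_n) (v : n.-tuple M) i :
  tnth (proj s v) i = tnth v (s i).
Proof. by rewrite tnth_mktuple. Qed.

Lemma teval_rename n m (s : 'I_n -> 'I_m) (v : m.-tuple M) (t : term L n) :
  teval v (trename s t) = teval (proj s v) t.
Proof.
elim: t => [i|f ts IH] /=; first by rewrite projE.
by congr finterp; apply: eq_from_tnth => i; rewrite !tnth_mktuple IH.
Qed.

Lemma proj_slift n m (s : 'I_n -> 'I_m) (v : m.-tuple M) x :
  proj (slift s) [tuple of x :: v] = [tuple of x :: proj s v].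
Proof.
apply: eq_from_tnth => i; rewrite projE /slift.
case: (unliftP ord0 i) => [j|] ->; last by rewrite !tnth0.
by rewrite !tnthS projE.
Qed.

Lemma sat_rename n (phi : formula L n) m (s : 'I_n -> 'I_m) (v : m.-tuple M) :
  sat (frename phi s) v <-> sat phi (proj s v).
Proof.
elim: phi m s v => {n} [n|n t u|n r ts|n f IHf g IHg|n f IHf] m s v //=.
- by rewrite !teval_rename.
- suff -> : [tuple teval v (trename s (ts i)) | i < rarity r] =
      [tuple teval (proj s v) (ts i) | i < rarity r] by [].
  by apply: eq_from_tnth => i; rewrite !tnth_mktuple teval_rename.
- by split=> H /IHf /H /IHg.
- by split=> H x; have := H x; rewrite IHf proj_slift.
Qed.

Lemma sat_and n (phi psi : formula L n) (v : n.-tuple M) :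
  sat (FAnd phi psi) v <-> sat phi v /\ sat psi v.
Proof.
rewrite /FAnd /=; split=> [/not_implyP[Hf /contrapT Hg]|[Hf Hg] H]; first by split.
exact: H.
Qed.

Lemma sat_ex n (phi : formula L n.+1) (v : n.-tuple M) :
  sat (FEx phi) v <-> exists x, sat phi [tuple of x :: v].
Proof.
rewrite /FEx /=; split=> [H|[x Hx] H]; last exact: H Hx.
by apply: contrapT => Hn; apply: H => x Hx; apply: Hn; exists x.
Qed.

Lemma sat_exs k m (phi : formula L (k + m)) (v : m.-tuple M) :
  sat (FExs phi) v <-> exists u : k.-tuple M, sat phi [tuple of u ++ v].
Proof.
elim: k phi => [|k IH] phi /=.
  split=> [Hv|[u]]; first exists [tuple];
    by [suff <- : v = [tuple of [tuple] ++ v] by []; apply: val_inj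
       |rewrite (tuple0 u); suff -> : [tuple of [tuple] ++ v] = v by []; apply: val_inj].
rewrite IH; split=> -[u].
- move=> /sat_ex[x Hx]; exists [tuple of x :: u].
  suff -> : [tuple of [tuple of x :: u] ++ v] = [tuple of x :: [tuple of u ++ v]] by [].
  exact: val_inj.
- rewrite (tuple_eta u) => Hx; exists [tuple of behead u]; apply/sat_ex; exists (thead u).
  move: Hx; set a := (X in sat phi X -> _); set b := (X in _ -> sat phi X).
  by suff -> : a = b by []; apply: val_inj.
Qed.

Lemma sat_bigand (I : finType) n (phi : I -> formula L n) (v : n.-tuple M) :
  sat (FBigAnd phi) v <-> forall i, sat (phi i) v.
Proof.
rewrite /FBigAnd.
suff H s : sat (foldr (fun i psi => FAnd (phi i) psi) (FNot FFalse) s) v <->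
    forall i, i \in s -> sat (phi i) v.
  by rewrite H; split=> h i; [apply: h; rewrite mem_enum|move=> _; apply: h].
elim: s => [|i s IH]; first by split=> // _ [].
change (sat (FAnd (phi i) (foldr (fun j psi => FAnd (phi j) psi) (FNot FFalse) s)) v <->
  forall j, j \in i :: s -> sat (phi j) v).
rewrite sat_and IH; split=> [[Hi Hs] j|H].
  by rewrite inE => /orP[/eqP->|/Hs].
by split=> [|j Hj]; apply: H; rewrite inE ?eqxx // Hj orbT.
Qed.

End FormulaOperations.

(** * Coding formulas injectively by trees of natural numbers *)

Section Coding.
Variable L : language.

Fixpoint tcode n (t : term L n) : GenTree.tree nat :=
  match t with
  | TVar i => GenTree.Leaf (i : nat)
  | TApp f ts => GenTree.Node (pickle f) [seq tcode (ts i) | i <- enum 'I_(farity f)]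
  end.

Lemma map_enum_inj (T : Type) n (f g : 'I_n -> T) :
  [seq f i | i <- enum 'I_n] = [seq g i | i <- enum 'I_n] -> f = g.
Proof.
move=> H; apply/funext => i.
have := congr1 (fun s => nth (f i) s i) H.
by rewrite /= (nth_map i) ?size_enum_ord // (nth_map i) ?size_enum_ord // nth_ord_enum.
Qed.

Lemma tcode_inj n : injective (@tcode n).
Proof.
elim=> [i|f ts IH] [j|g us] //=; first by case=> /val_inj->.
case=> /(pcan_inj pickleK) e; subst g => /map_enum_inj H.
by congr TApp; apply/funext => i; apply: IH; rewrite (congr1 (@^~ i) H).
Qed.

Fixpoint fcode n (phi : formula L n) : GenTree.tree nat :=
  match phi with
  | FFalse _ => GenTree.Node 0 [::]
  | FEq _ t u => GenTree.Node 1 [:: tcode t; tcode u]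
  | FRel _ r ts => GenTree.Node 2 (GenTree.Leaf (pickle r) ::
      [seq tcode (ts i) | i <- enum 'I_(rarity r)])
  | FImp _ f g => GenTree.Node 3 [:: fcode f; fcode g]
  | FAll _ f => GenTree.Node 4 [:: fcode f]
  end.

Lemma fcode_inj n : injective (@fcode n).
Proof.
move=> phi; elim: phi => {n} [n|n t u|n r ts|n f IHf g IHg|n f IHf] psi.
- by case: psi.
- case: n / psi t u => //= n t' u' t u [] /tcode_inj-> /tcode_inj->//.
- case: n / psi ts => //= n r' ts' ts [] /(pcan_inj pickleK) e; subst r' => /map_enum_inj H.
  by congr FRel; apply/funext => i; apply: tcode_inj; rewrite (congr1 (@^~ i) H).
- by case: n / psi f IHf g IHg => //= n f' g' f IHf g IHg [] /IHf-> /IHg->.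
- by case: n / psi f IHf => //= n f' f IHf [] /IHf->.
Qed.

End Coding.

(** * The Henkin construction *)



Section Henkin.
Variables (L : language) (M : structure L).
Hypothesis Minf : forall k (x : k.-tuple M), exists y, forall i, tnth x i <> y.

Definition restr k (v : nat -> M) : k.-tuple M := [tuple v i | i < k].

(** Conditions are sets of valuations of all variables, not formulas, so that enlarging the number
    [k] of variables in play leaves the set unchanged and only asks for another defining formula. *)
Definition supported k (E : set (nat -> M)) :=
  exists chi : formula L k, forall v, E v <-> sat chi (restr k v).

Lemma supported_local k E v v' : supported k E ->
  (forall i, (i < k)%N -> v i = v' i) -> E v -> E v'.
Proof.
move=> [chi H] Hv /H Hs; apply/H; suff <- : restr k v = restr k v' by [].
by apply: eq_from_tnth => i; rewrite !tnth_mktuple Hv.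
Qed.

Lemma supported_formula k m (phi : formula L m) (s : m.-tuple nat) :
  (forall i, (tnth s i < k)%N) -> supported k [set v | sat phi (map_tuple v s)].
Proof.
move=> Hs; exists (frename phi (fun i => Ordinal (Hs i))) => v /=.
rewrite sat_rename; suff -> : map_tuple v s =
  proj (fun i => Ordinal (Hs i)) (restr k v) by [].
by apply: eq_from_tnth => i; rewrite projE !tnth_map tnth_ord_tuple.
Qed.

Lemma supported_widen k k' E : (k <= k')%N -> supported k E -> supported k' E.
Proof.
move=> kk' [chi H].
have Hs (i : 'I_k) : (tnth [tuple val i | i < k] i < k')%N.
  by rewrite tnth_mktuple; apply: leq_trans kk'; apply: ltn_ord.
have [psi Hpsi] := supported_formula chi Hs; exists psi => v; rewrite -Hpsi H /=.
suff -> : restr k v = map_tuple v [tuple val i | i < k] by [].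
by apply: eq_from_tnth => i; rewrite !(tnth_map, tnth_ord_tuple).
Qed.

Lemma supportedI k E F : supported k E -> supported k F -> supported k (E `&` F).
Proof. by move=> [a Ha] [b Hb]; exists (FAnd a b) => v; rewrite sat_and -Ha -Hb. Qed.

Lemma supportedC k E : supported k E -> supported k (~` E).
Proof. by move=> [a Ha]; exists (FNot a) => v; split=> [H /Ha|H /Ha]. Qed.

Lemma supported_all k (I : finType) (E : I -> set (nat -> M)) :
  (forall i, supported k (E i)) -> supported k [set v | forall i, E i v].
Proof.
move=> /choice[f Hf]; exists (FBigAnd f) => v; rewrite sat_bigand.
by split=> H i; apply/Hf.
Qed.

Lemma supported_eq k i j : (i < k)%N -> (j < k)%N -> supported k [set v | v i = v j].
Proof.
move=> ik jk; exists (FEq (TVar L (Ordinal ik)) (TVar L (Ordinal jk))) => v /=.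
by rewrite !tnth_mktuple.
Qed.

Variables (n : nat) (p : set (set (n.-tuple M))).
Hypothesis pT : p setT.
Hypothesis pI : forall P Q, p P -> p Q -> p (P `&` Q).
Hypothesis p_inj : forall P, p P -> exists2 x, P x & injective (tnth x).

Lemma filter_all k (P : nat -> set (n.-tuple M)) : (forall j, (j < k)%N -> p (P j)) ->
  p [set x | forall j, (j < k)%N -> P j x].
Proof.
elim: k => [|k IH] H.
  by suff -> : [set x | forall j, (j < 0)%N -> P j x] = setT by []; apply/seteqP.
have := pI (IH (fun j jk => H j (ltnW jk))) (H k (ltnSn k)).
congr (p _); apply/seteqP; split=> x /=.
  by move=> [H1 H2] j; rewrite ltnS leq_eqVlt => /orP[/eqP->//|/H1].
by move=> Hx; split=> [j jk|]; apply: Hx; rewrite // ltnW.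
Qed.

(* The Henkin conditions: definable sets of valuations of the variables
   [x_0, ..., x_(k-1)], compatible with [p], all of whose members are injective;
   the latter makes the variables themselves the points of the final model. *)
Definition good k (E : set (nat -> M)) :=
  [/\ supported k E, (n <= k)%N,
    forall v, E v -> forall i j, (i < k)%N -> (j < k)%N -> v i = v j -> i = j &
    forall P, p P -> exists2 v, E v & P (restr n v)].

Definition upd (v : nat -> M) k y := fun i => if i == k then y else v i.

(** Adding the variable [x_k]: the new condition also demands that [x_k] differ from the earlier
    variables, to keep valuations injective. Hence the witness [y] has to avoid the values in
    use. *)
Lemma good_fresh k E (F : set (nat -> M)) : good k E -> supported k.+1 F ->
  (forall P, p P -> exists v y, [/\ E v, P (restr n v),
     forall j, (j < k)%N -> v j <> y & F (upd v k y)]) ->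
  exists2 E', E' `<=` E `&` F & good k.+1 E'.
Proof.
move=> [E1 E2 E3 E4] F1 Hp.
exists (E `&` F `&` [set v : nat -> M | forall i : 'I_k, v i <> v k]); first by move=> v [].
split; [|exact: leqW| |].
- apply: supportedI; first by apply: supportedI => //; apply: supported_widen E1.
  apply: supported_all => i; apply: supportedC; apply: supported_eq => //.
  by rewrite ltnW // ltnS.
- move=> v [[Ev _] Hv] i j; rewrite !ltnS (leq_eqVlt i) (leq_eqVlt j).
  move=> /orP[/eqP->|ik] /orP[/eqP->|jk] // e; last exact: (E3 v).
    by case: (Hv (Ordinal jk)).
  by case: (Hv (Ordinal ik)).
- move=> P /Hp[v [y [Ev Pv Hy Fv]]]; exists (upd v k y).
    split; first split=> //.
      by apply: (supported_local E1 _ Ev) => i ik; rewrite /upd ltn_eqF.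
    by move=> i /=; rewrite /upd eqxx ltn_eqF //; apply: Hy.
  suff -> : restr n (upd v k y) = restr n v by [].
  apply: eq_from_tnth => i; rewrite !tnth_mktuple /upd ltn_eqF //.
  by apply: leq_trans E2; apply: ltn_ord.
Qed.

Lemma good_grow k E : good k E -> exists2 E', E' `<=` E & good k.+1 E'.
Proof.
move=> gE; have [||E' E'E gE'] := @good_fresh k E setT gE.
- by exists (FNot FFalse) => v; split=> // _ [].
- move=> P Pp; case: (gE) => _ _ _ /(_ P Pp)[v Ev Pv].
  have [y Hy] := Minf (restr k v); exists v, y; split=> // j jk.
  by have := Hy (Ordinal jk); rewrite tnth_mktuple.
- by exists E' => // v /E'E[].
Qed.

Lemma good_grow_to k E K : good k E ->
  exists k' E', [/\ (k <= k')%N, (K <= k')%N, E' `<=` E & good k' E'].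
Proof.
move=> gE; elim: K => [|K [k' [E' [kk' Kk' E'E gE']]]]; first by exists k, E; split=> // v.
have [E'' H1 H2] := good_grow gE'; exists k'.+1, E''; split=> //.
  exact: leqW.
exact: subset_trans E'E.
Qed.

Lemma tuple_nat_bound m (s : m.-tuple nat) :
  exists K, forall K', (K <= K')%N -> forall i, (tnth s i < K')%N.
Proof.
exists (\max_(i < m) tnth s i).+1 => K' H i; apply: leq_trans H.
by rewrite ltnS (leq_bigmax_cond (F := fun i => tnth s i)).
Qed.

(** Henkin's witness property. It also yields completeness: for a formula under a dummy quantifier,
    it decides the formula itself. *)
Definition witnessed m (phi : formula L m.+1) (s : m.-tuple nat)
    (E : set (nat -> M)) :=
  (forall v, E v -> forall y, sat phi [tuple of y :: map_tuple v s]) \/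
  (exists j, forall v, E v -> ~ sat phi [tuple of v j :: map_tuple v s]).

Lemma good_cap k E F : good k E -> supported k F ->
  (forall P, p P -> exists v, [/\ E v, P (restr n v) & F v]) -> good k (E `&` F).
Proof.
move=> [E1 E2 E3 E4] F1 H; split=> //; first exact: supportedI.
  by move=> v [/E3].
by move=> P /H[v [? ? ?]]; exists v.
Qed.

(** Compatibility with [p] dictates the choice. If the universal formula is compatible, it is
    imposed; if a variable already in play can be a counterexample, this is imposed; otherwise, over
    a small enough member of [p], counterexamples exist and avoid all variables in play, and a fresh
    variable names one. *)
Lemma good_witness k E m (phi : formula L m.+1) (s : m.-tuple nat) : good k E ->
  exists k' E', [/\ (k <= k')%N, E' `<=` E, good k' E' & witnessed phi s E'].
Proof.
move=> gE; have [K /[dup] HK /(_ _ (leqnn _)) _] := tuple_nat_bound s.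
have [k1 [E1 [kk1 Kk1 E1E g1]]] := good_grow_to K gE.
have sk1 i : (tnth s i < k1)%N by apply: HK.
have sE j k' : (k1 <= k')%N -> (j < k')%N ->
    supported k' [set v | ~ sat phi [tuple of v j :: map_tuple v s]].
  move=> k1k' jk'; apply: supportedC.
  have Hs i : (tnth [tuple of j :: s] i < k')%N.
    by case: (unliftP ord0 i) => [i'|] ->; rewrite ?tnthS ?tnth0 // (leq_trans _ k1k').
  have [chi Hchi] := supported_formula phi Hs; exists chi => v; rewrite -Hchi /=.
  by suff -> : [tuple of v j :: map_tuple v s] = map_tuple v [tuple of j :: s] by []; apply: val_inj.
have [H|] := pselect (forall P, p P -> exists v, [/\ E1 v, P (restr n v) &
    forall y, sat phi [tuple of y :: map_tuple v s]]).
  exists k1; eexists; split; [exact: kk1| |apply: (good_cap g1 _ H)|].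
  - by move=> v [/E1E].
  - by have [chi Hchi] := supported_formula (FAll phi) sk1; exists chi => v; rewrite -Hchi.
  - by left=> v [].
move=> /existsNP[P0 /not_implyP[pP0 H0]].
have [[j jk1 H]|Hj] := pselect (exists2 j, (j < k1)%N & forall P, p P ->
    exists v, [/\ E1 v, P (restr n v) & ~ sat phi [tuple of v j :: map_tuple v s]]).
  exists k1; eexists; split; [exact: kk1| |apply: (good_cap g1 _ H)|].
  - by move=> v [/E1E].
  - exact: sE.
  - by right; exists j => v [].
(* Over [Pj j] the variable [x_j] is never a counterexample, and over [P0] the universal formula
   always fails; over their intersection the counterexample is a new point. *)
have /choice[Pj HPj] : forall j, exists P, (j < k1)%N -> p P /\ forall v, E1 v ->
    P (restr n v) -> sat phi [tuple of v j :: map_tuple v s].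
  move=> j; apply: contrapT => Hn; apply: Hj.
  have jk : (j < k1)%N by apply: contrapT => jk; apply: Hn; exists setT.
  exists j => // P pP; apply: contrapT => HP; apply: Hn; exists P => _; split=> // v Ev Pv.
  by apply: contrapT => Hs; apply: HP; exists v.
have pall := filter_all (fun j jk => (HPj j jk).1).
have [|E2 E2E g2] := good_fresh g1 (sE k1 k1.+1 (leqW (leqnn _)) (ltnSn _)); last first.
  by exists k1.+1, E2; split=> //; [exact: leqW|move=> v /E2E[/E1E]|right; exists k1 => v /E2E[]].
move=> P pP; case: (g1) => _ _ _ /(_ _ (pI pP (pI pP0 pall)))[v E1v [Pv [P0v Pallv]]].
have [y Hy] : exists y, ~ sat phi [tuple of y :: map_tuple v s].
  apply: contrapT => Hn; apply: H0; exists v; split=> // y.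
  by apply: contrapT => Hy; apply: Hn; exists y.
exists v, y; split=> //.
  by move=> j jk vy; apply: Hy; rewrite -vy; apply: (HPj j jk).2 => //; apply: Pallv.
move=> /=; suff -> : [tuple of upd v k1 y k1 :: map_tuple (upd v k1 y) s] =
  [tuple of y :: map_tuple v s] by [].
apply: val_inj; rewrite /= /upd eqxx; congr (_ :: _).
apply/eq_in_map => _ /tnthP[i ->]; rewrite ltn_eqF //; exact: sk1.
Qed.

Variables (m : nat) (q : set (formula L m)).

Definition omitted (s : m.-tuple nat) (E : set (nat -> M)) :=
  exists2 psi, q psi & forall v, E v -> ~ sat psi (map_tuple v s).

(** Kept abstract so that one construction can realise [p] or omit [q]: the obligation is trivial
    when [q] contains [FFalse], and for a trivial [p] it follows from the hypothesis of the omitting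
    types theorem. *)
Hypothesis good_omit : forall k E (s : m.-tuple nat), good k E ->
  exists k' E', [/\ (k <= k')%N, E' `<=` E, good k' E' & omitted s E'].

(** The first [n] variables are only asked to be distinct, which [p_inj] makes compatible with [p].
    The default [d] fills the coordinates from [n] on, which the condition ignores. *)
Lemma good_start : exists E, good n E.
Proof.
have [d _] := Minf [tuple].
exists [set v : nat -> M | forall ij : 'I_n * 'I_n, ij.1 != ij.2 -> ~ v ij.1 = v ij.2].
split=> //.
- apply: supported_all => -[i j] /=; case: (eqVneq i j) => _ /=.
    by exists (FNot FFalse) => v; split=> // _ [].
  have [chi Hchi] : supported n (~` [set v | v i = v j]).
    by apply: supportedC; apply: supported_eq.
  by exists chi => v; rewrite -Hchi; split=> [|? _]; [apply|].
- move=> v Hv i j ik jk vij; apply: contrapT => /eqP ij.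
  by apply: (Hv (Ordinal ik, Ordinal jk)).
- move=> P /p_inj[x Px xinj]; exists (nth d x).
    move=> [i j] /= /eqP ij; rewrite -!tnth_nth => e; exact/ij/xinj.
  suff -> : restr n (nth d x) = x by [].
  by apply: eq_from_tnth => i; rewrite tnth_mktuple (tnth_nth d).
Qed.

Definition req_code m' (phi : formula L m'.+1) (s : m'.-tuple nat) : nat :=
  pickle (m', fcode phi, tval s).

Lemma req_code_inj m1 (phi1 : formula L m1.+1) s1 m2 (phi2 : formula L m2.+1) s2 E :
  req_code phi1 s1 = req_code phi2 s2 -> witnessed phi1 s1 E -> witnessed phi2 s2 E.
Proof.
move=> /(pcan_inj pickleK)[] e; subst m2 => /fcode_inj-> e.
by have -> : s1 = s2 by apply: val_inj.
Qed.

(** Stage [i] treats the requirement with code [i], if any; once is enough, since later conditions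
    are smaller. Strict growth of the number of variables brings each variable under the injectivity
    clause of some condition. *)
Definition henkin_step (i : nat) (c c' : nat * set (nat -> M)) :=
  [/\ (c.1 < c'.1)%N, c'.2 `<=` c.2, good c'.1 c'.2,
    forall m' (phi : formula L m'.+1) s, req_code phi s = i -> witnessed phi s c'.2 &
    forall s : m.-tuple nat, pickle s = i -> omitted s c'.2].

Lemma henkin_step_exists i c : good c.1 c.2 -> exists c', henkin_step i c c'.
Proof.
move: c => [k E] /= gE.
have [k1 [E1 [kk1 E1E g1 H1]]] : exists k' E', [/\ (k <= k')%N, E' `<=` E, good k' E' &
    forall m' (phi : formula L m'.+1) s, req_code phi s = i -> witnessed phi s E'].
  have [[m' [phi [s e]]]|Hn] := pselect (exists m' (phi : formula L m'.+1) s, req_code phi s = i).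
    have [k' [E' [? ? ? Hw]]] := good_witness phi s gE; exists k', E'; split=> // m2 phi2 s2 e2.
    by apply: req_code_inj Hw; rewrite e e2.
  by exists k, E; split=> //; move=> // m' phi s e; case: Hn; exists m', phi, s.
have [k2 [E2 [kk2 E2E g2 H2]]] : exists k' E', [/\ (k1 <= k')%N, E' `<=` E1, good k' E' &
    forall s : m.-tuple nat, pickle s = i -> omitted s E'].
  have [[s e]|Hn] := pselect (exists s : m.-tuple nat, pickle s = i).
    have [k' [E' [? ? ? Hw]]] := good_omit s g1; exists k', E'; split=> // s2 e2.
    by have -> : s2 = s by apply: (pcan_inj pickleK); rewrite e e2.
  by exists k1, E1; split=> // s e; case: Hn; exists s.
have [E3 E3E g3] := good_grow g2; exists (k2.+1, E3); split=> //=.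
- by rewrite ltnS (leq_trans kk1).
- by move=> v /E3E/E2E/E1E.
- move=> m' phi s /H1[H|[j H]]; [left|right; exists j] => v /E3E/E2E; exact: H.
- by move=> s /H2[psi qpsi H]; exists psi => // v /E3E; apply: H.
Qed.

Lemma chain_exists : exists c : nat -> nat * set (nat -> M),
  good (c 0%N).1 (c 0%N).2 /\ forall i, henkin_step i (c i) (c i.+1).
Proof.
have [E0 g0] := good_start.
have /choice[f Hf] : forall ic : nat * (nat * set (nat -> M)), exists c',
    good ic.2.1 ic.2.2 -> henkin_step ic.1 ic.2 c'.
  move=> [i c]; have [g|g] := pselect (good c.1 c.2); last by exists c.
  by have [c' ?] := henkin_step_exists i g; exists c'.
pose c := fix c i := if i is j.+1 then f (j, c j) else (n, E0).
exists c; have gc i : good (c i).1 (c i).2.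
  by elim: i => [|i IH] //=; case: (Hf (i, c i) IH).
split=> [|i]; [exact: gc 0%N|exact: (Hf (i, c i) (gc i))].
Qed.

(** * The model defined by a generic chain of conditions *)

Section Generic.
Variable c : nat -> nat * set (nat -> M).
Hypothesis c0 : good (c 0%N).1 (c 0%N).2.
Hypothesis cS : forall i, henkin_step i (c i) (c i.+1).

Definition forced (E : set (nat -> M)) := exists i, (c i).2 `<=` E.

Lemma chain_good i : good (c i).1 (c i).2.
Proof. by case: i => [|i] //; case: (cS i). Qed.

Lemma chain_sub i j : (i <= j)%N -> (c j).2 `<=` (c i).2.
Proof.
elim: j => [|j IH]; first by rewrite leqn0 => /eqP->.
rewrite leq_eqVlt => /orP[/eqP->//|]; rewrite ltnS => /IH H.
by case: (cS j) => _ H' _ _ _; apply: subset_trans H.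
Qed.

Lemma chain_dim i : (i <= (c i).1)%N.
Proof. by elim: i => // i IH; case: (cS i) => H _ _ _ _; apply: leq_ltn_trans H. Qed.

Lemma forced_mono (E F : set (nat -> M)) : E `<=` F -> forced E -> forced F.
Proof. by move=> EF [i H]; exists i; apply: subset_trans EF. Qed.

Lemma forcedI (E F : set (nat -> M)) : forced E -> forced F -> forced (E `&` F).
Proof.
move=> [i Hi] [j Hj]; exists (maxn i j) => v Hv; split.
  by apply: Hi; apply: chain_sub Hv; rewrite leq_maxl.
by apply: Hj; apply: chain_sub Hv; rewrite leq_maxr.
Qed.

Lemma forced_all k (E : 'I_k -> set (nat -> M)) : (forall i, forced (E i)) ->
  forced [set v | forall i, E i v].
Proof.
move=> /choice[f Hf]; exists (\max_i f i) => v Hv i.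
by apply: (Hf i); apply: chain_sub Hv; apply: leq_bigmax_cond.
Qed.

Lemma forced_nonempty E : forced E -> E !=set0.
Proof. by move=> [i Hi]; case: (chain_good i) => _ _ _ /(_ _ pT)[v /Hi ? _]; exists v. Qed.

(** Late conditions only contain valuations that separate [i] and [j]. This makes equality in the
    generic model genuine equality of variables. *)
Lemma forced_inj i j : forced [set v | v i = v j] -> i = j.
Proof.
move=> H; have : forced ([set v | v i = v j] `&` (c (maxn i j).+1).2).
  by apply: forcedI => //; exists (maxn i j).+1.
move=> /forced_nonempty[v [vij Hv]].
case: (chain_good (maxn i j).+1) => _ _ /(_ v Hv) Hinj _; apply: Hinj => //.
  by apply: leq_trans (chain_dim _); rewrite ltnS leq_maxl.
by apply: leq_trans (chain_dim _); rewrite ltnS leq_maxr.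
Qed.

Lemma forced_witness m' (phi : formula L m'.+1) s :
  forced [set v | sat (FAll phi) (map_tuple v s)] \/
  exists j, forced [set v | ~ sat phi [tuple of v j :: map_tuple v s]].
Proof.
case: (cS (req_code phi s)) => _ _ _ /(_ _ phi s erefl)[H|[j H]] _.
  by left; exists (req_code phi s).+1.
by right; exists j, (req_code phi s).+1.
Qed.

Lemma forced_decide m' (phi : formula L m') s :
  forced [set v | sat phi (map_tuple v s)] \/
  forced [set v | ~ sat phi (map_tuple v s)].
Proof.
have E (v : nat -> M) y : proj (lift ord0) [tuple of y :: map_tuple v s] = map_tuple v s.
  by apply: eq_from_tnth => i; rewrite projE tnthS.
have [H|[j H]] := forced_witness (frename phi (lift ord0)) s; [left|right].
  by apply: forced_mono H => v /= /(_ (v 0%N)); rewrite sat_rename E.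
by apply: forced_mono H => v /=; rewrite sat_rename E.
Qed.

Definition gen_finterp (f : Defs.fsym L) (w : (farity f).-tuple nat) : nat :=
  xget 0%N [set j | forced [set v | v j = finterp (map_tuple v w)]].

Definition generic_model : structure L :=
  Structure gen_finterp
    (fun r w => forced [set v | rinterp (s := r) (map_tuple v w)]).

(** The formula saying that every [y] differs from [f(w)] is never true, so its witness clause
    provides a variable forced to equal [f(w)]; the default in [gen_finterp] is never taken. *)
Lemma gen_finterpP (f : Defs.fsym L) (w : (farity f).-tuple nat) :
  forced [set v | v (gen_finterp w) = finterp (map_tuple v w)].
Proof.
rewrite /gen_finterp; case: xgetP => // /(_ _)/= Hn.
pose phi : formula L (farity f).+1 :=
  FNot (FEq (TVar L ord0) (TApp (s := f) (fun i => TVar L (lift ord0 i)))).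
have E (v : nat -> M) y : sat phi [tuple of y :: map_tuple v w] <->
    y <> finterp (map_tuple v w).
  rewrite /phi /= tnth0; suff -> : [tuple tnth [tuple of y :: map_tuple v w] (lift ord0 i)
    | i < farity f] = map_tuple v w by [].
  by apply: eq_from_tnth => i; rewrite tnth_mktuple tnthS.
have [H|[j H]] := forced_witness phi w.
  have [v /= /(_ (finterp (map_tuple v w)))] := forced_nonempty H.
  by move=> /E.
case: (Hn j); apply: forced_mono H => v /= H.
by apply: contrapT => /E.
Qed.

Lemma gen_teval m' (t : term L m') (s : m'.-tuple generic_model) :
  forced [set v | v (teval s t) = teval (map_tuple v s) t].
Proof.
elim: t => [i|f ts /forced_all IH] /=.
  by exists 0%N => v _ /=; rewrite tnth_map.
have := forcedI IH (gen_finterpP [tuple teval s (ts i) | i < farity f]).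
apply: forced_mono => v [/= H1 ->]; congr finterp.
by apply: eq_from_tnth => i; rewrite !(tnth_map, tnth_ord_tuple) H1.
Qed.

(** The truth lemma. The implication case holds because the chain decides every formula, the
    universal case because of the witnesses, and the equality case by [forced_inj]. *)
Lemma gen_sat m' (phi : formula L m') (s : m'.-tuple generic_model) :
  sat phi s <-> forced [set v | sat phi (map_tuple v s)].
Proof.
elim: phi s => {m'} [k|k t u|k r ts|k f IHf g IHg|k f IHf] s.
- by split=> // /forced_nonempty[].
- have Ht := gen_teval t s; have Hu := gen_teval u s; split=> /= H.
    by apply: forced_mono (forcedI Ht Hu) => v /= [<- <-]; rewrite H.
  apply: forced_inj; apply: forced_mono (forcedI H (forcedI Ht Hu)) => v /=.
  by move=> [? [-> ->]].
- have Ht := forced_all (fun i => gen_teval (ts i) s); split=> /= H;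
    apply: forced_mono (forcedI H Ht) => v /= [+ E].
    by congr rinterp; apply: eq_from_tnth => i; rewrite !(tnth_map, tnth_ord_tuple) E.
  by congr rinterp; apply: eq_from_tnth => i; rewrite !(tnth_map, tnth_ord_tuple) E.
- split=> /= H; last first.
    by move=> /IHf Hf; apply/IHg; apply: forced_mono (forcedI H Hf) => v /= [].
  have [/IHf/H/IHg|] := forced_decide f s; apply: forced_mono => v //=.
- have E (v : nat -> M) j : map_tuple v [tuple of j :: s] = [tuple of v j :: map_tuple v s].
    exact: val_inj.
  split=> [H|H j].
    have [//|[j Hj]] := forced_witness f s.
    have /IHf Hf := H j; have [v /= []] := forced_nonempty (forcedI Hj Hf).
    by rewrite E.
  by apply/IHf; apply: forced_mono H => v /=; rewrite E; apply.
Qed.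

Lemma gen_elementarily_equivalent : elementarily_equivalent M generic_model.
Proof.
move=> phi; rewrite gen_sat.
have E (v : nat -> M) : map_tuple v ([tuple] : 0.-tuple nat) = [tuple] by apply: val_inj.
by split=> [H|/forced_nonempty[v /=]]; [exists 0%N => v _ /=|]; rewrite E.
Qed.

(** If the negation of [psi] were forced, some condition would imply it, against the compatibility
    of that condition with the member of [p] defined by [psi]. *)
Lemma gen_realises : exists u : n.-tuple generic_model,
  forall psi, p (sat psi) -> sat psi u.
Proof.
exists [tuple val i | i < n] => psi ppsi; rewrite gen_sat.
have [//|[i Hi]] := forced_decide psi [tuple val i | i < n].
case: (chain_good i) => _ _ _ /(_ _ ppsi)[v /Hi /= H1 H2]; case: H1.
suff -> : map_tuple v [tuple val i | i < n] = restr n v by [].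
by apply: eq_from_tnth => j; rewrite !(tnth_map, tnth_ord_tuple).
Qed.

Lemma gen_omits (w : m.-tuple generic_model) : exists2 psi, q psi & ~ sat psi w.
Proof.
case: (cS (pickle (w : m.-tuple nat))) => _ _ _ _ /(_ w erefl)[psi qpsi H].
exists psi => // /gen_sat[j Hj].
have : forced ([set v | sat psi (map_tuple v w)] `&` (c (pickle (w : m.-tuple nat)).+1).2).
  by apply: forcedI; [exists j|exists (pickle (w : m.-tuple nat)).+1].
by move=> /forced_nonempty[v [/= ? /H]].
Qed.

End Generic.

Theorem henkin : exists N : structure L,
  [/\ countably_infinite N, elementarily_equivalent M N,
    exists u : n.-tuple N, forall psi, p (sat psi) -> sat psi u &
    forall w : m.-tuple N, exists2 psi, q psi & ~ sat psi w].
Proof.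
have [c [c0 cS]] := chain_exists; exists (generic_model c); split.
- exact: card_eqxx.
- exact: gen_elementarily_equivalent.
- exact: gen_realises.
- exact: gen_omits.
Qed.

End Henkin.

(** * Finiteness of the number of types *)



Definition eqv (L : language) (M N : structure L) n (x : n.-tuple M) (y : n.-tuple N) :=
  forall phi : formula L n, sat phi x <-> sat phi y.

Section RyllNardzewski.
Variable L : language.
Implicit Types M N : structure L.

Lemma equiv_exists M N : elementarily_equivalent M N ->
  forall k (phi : formula L k), (exists v : k.-tuple M, sat phi v) ->
  exists v : k.-tuple N, sat phi v.
Proof.
move=> MN k phi.
have E (P : structure L) (u : k.-tuple P) : proj (lshift 0) [tuple of u ++ [tuple]] = u.
  by apply: eq_from_tnth => i; rewrite projE tnth_lshift.
move=> [v Hv]; have : sat (FExs (frename phi (lshift 0))) ([tuple] : 0.-tuple N).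
  by apply/MN/sat_exs; exists v; apply/sat_rename; rewrite E.
by move=> /sat_exs[u /sat_rename]; rewrite E; exists u.
Qed.

Lemma elementarily_equivalent_sym M N :
  elementarily_equivalent M N -> elementarily_equivalent N M.
Proof. by move=> H phi; split=> /H. Qed.

Lemma isomorphic_eqv M N : isomorphic M N ->
  exists f : M -> N, bijective f /\ forall n (x : n.-tuple M), eqv x (map_tuple f x).
Proof.
move=> [f [fbij ff fr]]; exists f; split=> // n x phi.
have Ht k (y : k.-tuple M) (t : term L k) : f (teval y t) = teval (map_tuple f y) t.
  elim: t => [i|s ts IH] /=; first by rewrite tnth_map.
  rewrite ff; congr finterp; apply: eq_from_tnth => i.
  by rewrite !(tnth_map, tnth_ord_tuple) IH.
elim: phi x => {n} [n|n t u|n r ts|n g IHg h IHh|n g IHg] x //=.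
- by rewrite -!Ht; split=> [->|/(bij_inj fbij)].
- rewrite fr; suff -> : map_tuple f [tuple teval x (ts i) | i < rarity r] =
    [tuple teval (map_tuple f x) (ts i) | i < rarity r] by [].
  by apply: eq_from_tnth => i; rewrite !(tnth_map, tnth_ord_tuple) Ht.
- by rewrite IHg IHh.
- have E y : map_tuple f [tuple of y :: x] = [tuple of f y :: map_tuple f x].
    exact: val_inj.
  split=> [H y|H y]; last by rewrite IHg E.
  by case: fbij => f' _ f'K; have := H (f' y); rewrite IHg E f'K.
Qed.

Lemma countably_infinite_fresh (T : Type) : countably_infinite T ->
  forall k (x : k.-tuple T), exists y, forall i, tnth x i <> y.
Proof.
move=> Tinf k x; apply: contrapT => Hn; apply: infinite_nat.
rewrite -(eq_finite_set Tinf).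
apply: (@sub_finite_set _ _ (range (tnth x))); last first.
  by apply: finite_image; apply: finite_finset.
move=> y _; apply: contrapT => Hy; apply: Hn; exists y => i xi.
by apply: Hy; exists i.
Qed.

Lemma equiv_fresh M N : elementarily_equivalent M N ->
  (forall k (x : k.-tuple N), exists y, forall i, tnth x i <> y) ->
  forall k (x : k.-tuple M), exists y, forall i, tnth x i <> y.
Proof.
move=> MN Ninf k x; apply: contrapT => Hn.
pose phi : formula L k := FNot (FEx (FBigAnd
  (fun i : 'I_k => FNot (FEq (TVar L (lift ord0 i)) (TVar L ord0))))).
have E (P : structure L) (u : k.-tuple P) :
    sat phi u <-> ~ exists y, forall i, tnth u i <> y.
  have E' : sat (FEx (FBigAnd
      (fun i : 'I_k => FNot (FEq (TVar L (lift ord0 i)) (TVar L ord0))))) u <->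
      exists y, forall i, tnth u i <> y.
    rewrite sat_ex; split=> -[y Hy]; exists y.
      by move/sat_bigand: Hy => Hy i; have := Hy i; rewrite /= tnthS tnth0.
    by apply/sat_bigand => i; have := Hy i; rewrite /= tnthS tnth0.
  by split=> H /E'.
have [|u /E] := equiv_exists MN (phi := phi); first by exists x; apply/E.
exact.
Qed.

(** The values that a condition allows for the variables listed in [s] form a non-empty definable
    set; by hypothesis some member of this set violates a formula of [q], and the condition is
    shrunk accordingly. *)
Lemma omitting_types M m (q : set (formula L m)) :
  (forall k (x : k.-tuple M), exists y, forall i, tnth x i <> y) ->
  (forall chi : formula L m, (exists x : m.-tuple M, sat chi x) ->
     exists2 psi, q psi & exists2 x : m.-tuple M, sat chi x & ~ sat psi x) ->
  exists N, [/\ countably_infinite N, elementarily_equivalent M N &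
    forall w : m.-tuple N, exists2 psi, q psi & ~ sat psi w].
Proof.
move=> Minf Hq; pose p : set (set (0.-tuple M)) := [set setT].
have [|P Q -> ->|P ->|k E s gE|N [N1 N2 _ N4]] := @henkin _ M Minf 0 p _ _ _ m q.
- by [].
- exact: setTI.
- by exists [tuple] => // -[].
- have [K HK] := tuple_nat_bound s.
  have [k1 [E1 [kk1 Kk1 E1E g1]]] := good_grow_to Minf K gE.
  have sk1 := HK _ Kk1.
  case: (g1) => -[chi0 Hchi0] _ _ /(_ setT erefl)[v0 E1v0 _].
  (* [chi] defines the possible values of the variables in [s] under the condition [E1]. *)
  pose chi : formula L m := FExs (FAnd (frename chi0 (@lshift k1 m))
    (FBigAnd (fun i : 'I_m => FEq (TVar L (rshift k1 i))
      (TVar L (lshift m (Ordinal (sk1 i))))))).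
  have Hchi w : sat chi w <-> exists2 v, E1 v & w = map_tuple v s.
    rewrite sat_exs; split=> [[u /sat_and[]]|[v Ev ->]].
      move=> /sat_rename; have -> : proj (@lshift k1 m) [tuple of u ++ w] = u.
        by apply: eq_from_tnth => i; rewrite projE tnth_lshift.
      move=> Hu /sat_bigand Hw; have [d _] := Minf _ [tuple].
      exists (nth d u).
        apply/Hchi0; suff -> : restr k1 (nth d u) = u by [].
        by apply: eq_from_tnth => i; rewrite tnth_mktuple (tnth_nth d).
      apply: eq_from_tnth => i; have /= := Hw i.
      by rewrite tnth_lshift tnth_rshift tnth_map (tnth_nth d u).
    exists (restr k1 v); apply/sat_and; split.
      apply/sat_rename; move/Hchi0: Ev.
      suff -> : proj (@lshift k1 m) [tuple of restr k1 v ++ map_tuple v s] = restr k1 v by [].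
      by apply: eq_from_tnth => i; rewrite projE tnth_lshift.
    by apply/sat_bigand => i /=; rewrite tnth_lshift tnth_rshift tnth_map tnth_mktuple.
  have [|psi qpsi [w /Hchi[v Ev ->] Hv]] := Hq chi.
    by exists (map_tuple v0 s); apply/Hchi; exists v0.
  exists k1, (E1 `&` ~` [set v | sat psi (map_tuple v s)]); split=> //.
  + by move=> u [/E1E].
  + apply: (good_cap g1).
      by apply: supportedC; apply: supported_formula.
    by move=> P ->; exists v.
  + by exists psi => // u [].
- by exists N.
Qed.

Lemma realising_filter M n (p : set (set (n.-tuple M))) :
  (forall k (x : k.-tuple M), exists y, forall i, tnth x i <> y) ->
  p setT -> (forall P Q, p P -> p Q -> p (P `&` Q)) ->
  (forall P, p P -> exists2 x, P x & injective (tnth x)) ->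
  exists N, [/\ countably_infinite N, elementarily_equivalent M N &
    exists u : n.-tuple N, forall psi, p (sat psi) -> sat psi u].
Proof.
move=> Minf pT pI pinj.
(* The set to be omitted is [FFalse] alone, which every condition omits. *)
have [k E s gE|N [N1 N2 N3 _]] := @henkin _ M Minf n p pT pI pinj 0 [set FFalse].
  by exists k, E; split; [exact: leqnn|exact: subset_refl|exact: gE|exists FFalse => // v _ []].
by exists N.
Qed.

Variable M : structure L.
Hypothesis Hcat : omega_categorical M.

Lemma omega_categorical_fresh k (x : k.-tuple M) : exists y, forall i, tnth x i <> y.
Proof.
case: Hcat => N [Ninf MN _]; apply: (equiv_fresh MN).
exact: countably_infinite_fresh.
Qed.

(** Otherwise the sets containing all injective tuples outside finitely many types form a filter. A
    tuple [u] realising it in one countable model has a type that another countable model omits,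
    although the two are isomorphic. *)
Lemma finitely_many_distinct n : exists (F : finType) (g : F -> n.-tuple M),
  forall x : n.-tuple M, injective (tnth x) -> exists i, eqv (g i) x.
Proof.
apply: contrapT => Hn.
pose p : set (set (n.-tuple M)) := [set P | exists (F : finType) (g : F -> n.-tuple M),
  forall x : n.-tuple M, injective (tnth x) -> (forall i, ~ eqv (g i) x) -> P x].
have [||||N1 [N1inf MN1 [u Hu]]] := @realising_filter M n p.
- exact: omega_categorical_fresh.
- by exists void, (of_void _).
- move=> P Q [F [g Hg]] [F' [g' Hg']].
  exists (F + F')%type, (fun i => match i with inl i => g i | inr i => g' i end).
  move=> x xinj Hx; split; first by apply: Hg => // i; apply: (Hx (inl i)).
  by apply: Hg' => // i; apply: (Hx (inr i)).
- move=> P [F [g Hg]]; apply: contrapT => HP; apply: Hn; exists F, g => x xinj.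
  apply: contrapT => Hi; apply: HP; exists x => //; apply: Hg => // i gi.
  by apply: Hi; exists i.
pose q : set (formula L n) := [set psi | sat psi u].
have [||N2 [N2inf MN2 HN2]] := @omitting_types M n q.
- exact: omega_categorical_fresh.
- move=> chi [x Hx]; apply: contrapT => Hchi.
  have Hq (y : n.-tuple M) psi : sat chi y -> sat psi u -> sat psi y.
    by move=> Hy Hpsi; apply: contrapT => Hny; apply: Hchi; exists psi => //; exists y.
  have Heq (y : n.-tuple M) : sat chi y -> eqv x y.
    move=> Hy psi; split=> H; apply: contrapT => HN.
      have [Hpsi|Hpsi] := pselect (sat psi u); first exact/HN/Hq.
      exact: (Hq x (FNot psi)).
    have [Hpsi|Hpsi] := pselect (sat psi u); first exact/HN/Hq.
    exact: (Hq y (FNot psi)).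
  (* If [chi] isolated the type of [u], it would define a single type in [M]; its negation would
     then lie in the filter, hold at [u], and so hold at the point [x] of [chi]. *)
  have /Hu Hnu : p (sat (FNot chi)).
    by exists unit, (fun=> x) => y _ Hy Hc; exact: (Hy tt (Heq y Hc)).
  exact: (Hq x _ Hx Hnu Hx).
case: Hcat => N0 [N0inf MN0 Huniq].
have [f1 [[g1 _ g1K] Hf1]] := isomorphic_eqv (Huniq N1 N1inf MN1).
have [f2 [_ Hf2]] := isomorphic_eqv (Huniq N2 N2inf MN2).
have [psi qpsi] := HN2 (map_tuple f2 (map_tuple g1 u)).
apply; apply/Hf2/Hf1.
suff -> : map_tuple f1 (map_tuple g1 u) = u by [].
by apply: eq_from_tnth => i; rewrite !tnth_map g1K.
Qed.

End RyllNardzewski.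

(** * Partial elementary maps *)



Section PartialElementaryMaps.
Variable L : language.
Implicit Types M N P : structure L.

Lemma eqv_sym M N n (x : n.-tuple M) (y : n.-tuple N) : eqv x y -> eqv y x.
Proof. by move=> H phi; split=> /H. Qed.

Lemma eqv_trans M N P n (x : n.-tuple M) (y : n.-tuple N) (z : n.-tuple P) :
  eqv x y -> eqv y z -> eqv x z.
Proof. by move=> H1 H2 phi; rewrite H1 H2. Qed.

Lemma eqv_proj M N n m (s : 'I_m -> 'I_n) (x : n.-tuple M) (y : n.-tuple N) :
  eqv x y -> eqv (proj s x) (proj s y).
Proof. by move=> H phi; rewrite -!sat_rename. Qed.

(* [G], a set of pairs, is a partial elementary map. *)
Definition pel M N (G : set (M * N)) :=
  forall n (phi : formula L n) (z : n.-tuple (M * N)), entries z `<=` G ->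
    (sat phi (map_tuple fst z) <-> sat phi (map_tuple snd z)).

(** Maps are sets of pairs, so that concatenation of tuples becomes union, and reordering or
    repeating entries changes nothing. *)
Definition gr (T U : Type) n (x : n.-tuple T) (y : n.-tuple U) : set (T * U) :=
  range (fun i => (tnth x i, tnth y i)).

Lemma pel_sub M N (G G' : set (M * N)) : G' `<=` G -> pel G -> pel G'.
Proof. by move=> G'G H n phi z zG'; apply: H; apply: subset_trans G'G. Qed.

Lemma gr_lift (T U : Type) n (x : n.-tuple T) (y : n.-tuple U) m (z : m.-tuple (T * U)) :
  entries z `<=` gr x y ->
  exists t : 'I_m -> 'I_n, forall i, tnth z i = (tnth x (t i), tnth y (t i)).
Proof.
move=> H; have /choice[t Ht] : forall i, exists j, tnth z i = (tnth x j, tnth y j).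
  by move=> i; have [|j _ <-] := H (tnth z i); [exists i|exists j].
by exists t.
Qed.

Lemma pel_gr M N n (x : n.-tuple M) (y : n.-tuple N) : pel (gr x y) <-> eqv x y.
Proof.
split=> [H phi|H m phi z /gr_lift[t Ht]].
  have := H n phi [tuple (tnth x i, tnth y i) | i < n].
  have -> : map_tuple fst [tuple (tnth x i, tnth y i) | i < n] = x.
    by apply: eq_from_tnth => i; rewrite !(tnth_map, tnth_ord_tuple).
  have -> : map_tuple snd [tuple (tnth x i, tnth y i) | i < n] = y.
    by apply: eq_from_tnth => i; rewrite !(tnth_map, tnth_ord_tuple).
  by apply=> _ [i _ <-]; exists i => //; rewrite tnth_mktuple.
have -> : map_tuple fst z = proj t x.
  by apply: eq_from_tnth => i; rewrite tnth_map Ht projE.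
have -> : map_tuple snd z = proj t y.
  by apply: eq_from_tnth => i; rewrite tnth_map Ht projE.
exact: eqv_proj.
Qed.

Lemma gr_cat (T U : Type) n m (x : n.-tuple T) (y : n.-tuple U) (u : m.-tuple T) (v : m.-tuple U) :
  gr [tuple of x ++ u] [tuple of y ++ v] = gr x y `|` gr u v.
Proof.
apply/seteqP; split=> [_ [i _ <-]|_ [[i _ <-]|[i _ <-]]].
- case: (split_ordP i) => j ->; [left|right]; exists j => //.
    by rewrite !tnth_lshift.
  by rewrite !tnth_rshift.
- by exists (lshift m i) => //; rewrite !tnth_lshift.
- by exists (rshift n i) => //; rewrite !tnth_rshift.
Qed.

Lemma gr_proj (T U : structure L) n m (s : 'I_m -> 'I_n) (x : n.-tuple T) (y : n.-tuple U) :
  gr (proj s x) (proj s y) `<=` gr x y.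
Proof. by move=> _ [i _ <-]; exists (s i) => //; rewrite !projE. Qed.

Lemma pel_sym M N n (x : n.-tuple M) (y : n.-tuple N) : pel (gr x y) -> pel (gr y x).
Proof. by move=> /pel_gr/eqv_sym/pel_gr. Qed.

Lemma pel_trans M N P n (x : n.-tuple M) (y : n.-tuple N) (z : n.-tuple P) :
  pel (gr x y) -> pel (gr y z) -> pel (gr x z).
Proof. by move=> /pel_gr H /pel_gr H'; apply/pel_gr; apply: eqv_trans H'. Qed.

Lemma eqv_catC M N n k (x : n.-tuple M) (y : n.-tuple N) (u : k.-tuple M) (v : k.-tuple N) :
  eqv [tuple of u ++ x] [tuple of v ++ y] <-> pel (gr x y `|` gr u v).
Proof. by rewrite -pel_gr gr_cat setUC. Qed.

End PartialElementaryMaps.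

(** * Isolated types, invariant sets and back-and-forth *)

Section FinitelyManyTypes.
Variables (L : language) (M : structure L).
Hypothesis Hcat : omega_categorical M.

Lemma distinct_entries (T : Type) n (x : n.-tuple T) : exists (k : 'I_n.+1) (e : k.-tuple T)
  (t : {ffun 'I_n -> 'I_k}), injective (tnth e) /\ x = [tuple tnth e (t i) | i < n].
Proof.
pose s : seq {classic T} := undup (x : seq {classic T}).
have sn : (size s < n.+1)%N by rewrite ltnS (leq_trans (size_undup _)) // size_tuple.
have ti (i : 'I_n) : (index (tnth x i : {classic T}) s < size s)%N.
  by rewrite index_mem mem_undup; apply: (@mem_tnth _ {classic T}).
exists (Ordinal sn), (in_tuple s : (size s).-tuple {classic T}), [ffun i => Ordinal (ti i)]; split.
  exact/(tuple_uniqP (in_tuple s : (size s).-tuple {classic T}))/undup_uniq.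
apply: eq_from_tnth => i; rewrite tnth_mktuple ffunE [RHS](tnth_nth (tnth x i)) /=.
by symmetry; apply: (@nth_index {classic T}); rewrite -index_mem.
Qed.

Lemma finitely_many_types n : exists (F : finType) (g : F -> n.-tuple M),
  forall x : n.-tuple M, exists i, eqv (g i) x.
Proof.
pose Fk k := projT1 (cid (finitely_many_distinct Hcat k)).
have gk k := projT2 (cid (finitely_many_distinct Hcat k)).
pose g k := projT1 (cid (gk k)).
have Hg k : forall x : k.-tuple M, injective (tnth x) -> exists i, eqv (g k i) x.
  exact: projT2 (cid (gk k)).
(* A type is coded by the number [k] of distinct entries, the type of the tuple of these, and the
   map that places them. *)
pose F : finType := {k : 'I_n.+1 & (Fk k * {ffun 'I_n -> 'I_k})%type}.
exists F, (fun i : F => proj (tagged i).2 (g _ (tagged i).1)) => x.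
have [k [e [t [einj ->]]]] := distinct_entries x.
have [j Hj] := Hg _ e einj.
exists (Tagged (fun k : 'I_n.+1 => (Fk k * {ffun 'I_n -> 'I_k})%type) (j, t)).
exact: eqv_proj.
Qed.

(** For each of finitely many representatives of types, take a formula true at [x], and false at the
    representative if its type is different; their conjunction isolates. *)
Lemma isolating_formula n (x : n.-tuple M) : exists chi : formula L n,
  sat chi x /\ forall y : n.-tuple M, sat chi y -> eqv x y.
Proof.
have [F [g Hg]] := finitely_many_types n.
have /choice[f Hf] : forall i, exists psi, sat psi x /\ (sat psi (g i) -> eqv x (g i)).
  move=> i; have [H|H] := pselect (eqv x (g i)); first by exists (FNot FFalse); split=> [[]|_].
  apply: contrapT => Hn; apply: H => psi; split=> Hpsi; apply: contrapT => Hpsi'.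
    by apply: Hn; exists psi.
  by apply: Hn; exists (FNot psi); split=> [/Hpsi'|/(_ Hpsi)].
exists (FBigAnd f); split; first by apply/sat_bigand => i; case: (Hf i).
move=> y /sat_bigand Hy; have [i Hi] := Hg y.
by apply: (eqv_trans _ Hi); apply: (Hf i).2; apply/Hi/Hy.
Qed.

(** The substitute for invariance under automorphisms: [X] is a union of some of the finitely many
    isolated types. The disjunction of the isolating formulas is written as a negated
    conjunction. *)
Lemma invariant_formula n (X : set (n.-tuple M)) :
  (forall x y, eqv x y -> X x -> X y) -> exists phi, forall x, sat phi x <-> X x.
Proof.
move=> HX; have [F [g Hg]] := finitely_many_types n.
have /choice[f Hf] := fun i => isolating_formula (g i).
exists (FNot (FBigAnd (fun i => if `[< X (g i) >] then FNot (f i) else FNot FFalse))) => x.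
split=> [H|Xx /sat_bigand].
  apply: contrapT => Xx; apply: H; apply/sat_bigand => i; case: asboolP => [Xi fx|_ //].
  by apply: Xx; apply: HX Xi; apply: (Hf i).2.
have [i Hi] := Hg x; move=> /(_ i); case: asboolP => [_|Xi _]; last first.
  by apply: Xi; apply: HX Xx; apply: eqv_sym.
by apply; apply/Hi; apply: (Hf i).1.
Qed.

Section Equivalent.
Variable N : structure L.
Hypothesis MN : elementarily_equivalent M N.

(** A type of [N] missing from [M] would be separated from each of the finitely many types of [M] by
    a formula; the conjunction of these is satisfiable in [N], hence in [M]. *)
Lemma type_realised n (y : n.-tuple N) : exists x : n.-tuple M, eqv x y.
Proof.
have [F [g Hg]] := finitely_many_types n; apply: contrapT => Hn.
have /choice[f Hf] : forall i, exists psi, sat psi y /\ ~ sat psi (g i).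
  move=> i; apply: contrapT => Hn'; apply: Hn; exists (g i) => psi.
  split=> H; apply: contrapT => H'; apply: Hn'; last by exists psi.
  by exists (FNot psi); split=> // /(_ H).
have [|x /sat_bigand Hx] := equiv_exists (elementarily_equivalent_sym MN) (phi := FBigAnd f).
  by exists y; apply/sat_bigand => i; case: (Hf i).
by have [i Hi] := Hg x; apply: (Hf i).2; apply/Hi.
Qed.

(** A formula isolating the type of [u ++ x] carries the existence of an extension over to [N].
    Isolation is only known among tuples of [M], so the tuple found in [N] is compared through a
    tuple of [M] of the same type. *)
Lemma pel_forth n k (x : n.-tuple M) (y : n.-tuple N) (u : k.-tuple M) :
  pel (gr x y) -> exists v : k.-tuple N, pel (gr x y `|` gr u v).
Proof.
move=> /pel_gr xy; have [chi [chi1 chi2]] := isolating_formula [tuple of u ++ x].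
have /xy/sat_exs[v Hv] : sat (FExs chi) x by apply/sat_exs; exists u.
exists v; apply/eqv_catC; have [w Hw] := type_realised [tuple of v ++ y].
by apply: (eqv_trans _ Hw); apply: chi2; apply/Hw.
Qed.

Lemma pel_back n k (x : n.-tuple M) (y : n.-tuple N) (v : k.-tuple N) :
  pel (gr x y) -> exists u : k.-tuple M, pel (gr x y `|` gr u v).
Proof.
move=> /pel_gr xy; have [w Hw] := type_realised [tuple of v ++ y].
have [chi [chi1 chi2]] := isolating_formula w.
have /xy/sat_exs[u Hu] : sat (FExs chi) y by apply/sat_exs; exists v; apply/Hw.
exists u; apply/eqv_catC; apply: eqv_trans Hw; apply: eqv_sym; exact: chi2.
Qed.

End Equivalent.

Definition invariant_over n m (e : m.-tuple M) (X : set (n.-tuple M)) :=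
  forall x x', pel (gr x x' `|` gr e e) -> X x -> X x'.

Lemma psat_invariant n (phi : pformula M n) : invariant_over (ppar phi) (psat phi).
Proof. by move=> x x'; rewrite -gr_cat pel_gr /psat => H /H. Qed.

(** [X] is spread over all copies of [e]: [phi] says that a tuple has the type of some [x ++ e] with
    [x] in [X]. Invariance ensures that the fibre over [e] itself is no larger than [X]. *)
Lemma invariant_fiber n m (e : m.-tuple M) (X : set (n.-tuple M)) : invariant_over e X ->
  exists phi, X = fiber phi e.
Proof.
move=> HX.
have [phi Hphi] : exists phi : formula L (n + m), forall z : (n + m).-tuple M, sat phi z <->
    exists2 x : n.-tuple M, eqv z [tuple of x ++ e] & X x.
  apply: invariant_formula => z z' zz' [x zx Xx]; exists x => //.
  exact: eqv_trans (eqv_sym zz') zx.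
exists phi; apply/seteqP; split=> x; rewrite /fiber /= Hphi; first by exists x.
by move=> [x' xx']; apply: HX; rewrite -gr_cat pel_gr; apply: eqv_sym.
Qed.

Lemma invariant_in_Def n m (e : m.-tuple M) (X : set (n.-tuple M)) : (0 < n)%N ->
  X !=set0 -> invariant_over e X -> in_Def X.
Proof.
move=> n0 X0 HX; split=> //; have [phi ->] := invariant_fiber HX.
by exists (PFormula phi e).
Qed.

End FinitelyManyTypes.

(** * Definable sets and Fubini *)



Section ParametricallyDefinable.
Variables (L : language) (M : structure L).

Lemma pel_eq (N : structure L) (G : set (M * N)) a b a' b' : pel G ->
  G (a, b) -> G (a', b') -> a = a' <-> b = b'.
Proof.
move=> pG Gab Gab'; have := pG 2 (FEq (TVar L ord0) (TVar L (lift ord0 ord0)))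
  [tuple (a, b); (a', b')]; rewrite /= !(tnth_nth a) !(tnth_nth b) /=; apply.
by move=> _ [i _ <-]; case: (unliftP ord0 i) => [j|] ->; rewrite ?(ord1 j) ?tnthS ?tnth0.
Qed.

Lemma pel_proj (N : structure L) n m (s : 'I_m -> 'I_n) (x : n.-tuple M) (x' : n.-tuple N)
    (y : m.-tuple M) (y' : m.-tuple N) :
  pel (gr x x' `|` gr y y') -> proj s x = y <-> proj s x' = y'.
Proof.
move=> H; split=> E; apply: eq_from_tnth => i; rewrite projE.
  apply: (pel_eq H (a := tnth x (s i)) (a' := tnth y i) _ _).1.
  - by left; exists (s i).
  - by right; exists i.
  - by rewrite -E projE.
apply: (pel_eq H (b := tnth x' (s i)) (b' := tnth y' i) _ _).2.
- by left; exists (s i).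
- by right; exists i.
- by rewrite -E projE.
Qed.

(** Unlike [in_Def], this admits the empty set and arity [0], and Boolean operations require no
    manipulation of formulas. *)
Definition pdefinable n (X : set (n.-tuple M)) :=
  exists m (e : m.-tuple M), invariant_over e X.

Lemma pdefinableI n (X Y : set (n.-tuple M)) :
  pdefinable X -> pdefinable Y -> pdefinable (X `&` Y).
Proof.
move=> [m [e He]] [m' [e' He']]; exists (m + m')%N, [tuple of e ++ e'] => x x'.
rewrite gr_cat => H [Xx Yx]; split.
  by apply: He Xx; apply: pel_sub H => z [?|?]; [left|right; left].
by apply: He' Yx; apply: pel_sub H => z [?|?]; [left|right; right].
Qed.

Lemma pdefinableC n (X : set (n.-tuple M)) : pdefinable X -> pdefinable (~` X).
Proof.
move=> [m [e He]]; exists m, e => x x'; rewrite -gr_cat => H Xx Xx'; apply: Xx.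
by apply: He Xx'; rewrite -gr_cat; apply: pel_sym.
Qed.

Lemma pdefinableU n (X Y : set (n.-tuple M)) :
  pdefinable X -> pdefinable Y -> pdefinable (X `|` Y).
Proof.
move=> X1 Y1; rewrite -[X `|` Y]setCK setCU; apply: pdefinableC.
by apply: pdefinableI; apply: pdefinableC.
Qed.

Lemma pdefinable0 n : pdefinable (set0 : set (n.-tuple M)).
Proof. by exists 0%N, [tuple] => x x' _ []. Qed.

Lemma pdefinable_fiber n m (s : 'I_m -> 'I_n) (a : m.-tuple M) :
  pdefinable (proj s @^-1` [set a]).
Proof. by exists m, a => x x' /(pel_proj s) H /H. Qed.

Lemma pdefinable_fin n (F : finType) (X : F -> set (n.-tuple M)) :
  (forall i, pdefinable (X i)) -> pdefinable [set x | forall i, X i x].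
Proof.
move=> HX; suff H (s : seq F) : pdefinable [set x | forall i, i \in s -> X i x].
  have := H (enum F); congr pdefinable; apply/seteqP; split=> x Hx i //=.
  by apply: Hx; rewrite mem_enum.
elim: s => [|j s IH].
  rewrite (_ : [set x | _] = ~` set0); first exact/pdefinableC/pdefinable0.
  by apply/seteqP; split=> x Hx.
rewrite (_ : [set x | _] = X j `&` [set x | forall i, i \in s -> X i x]); first exact: pdefinableI.
apply/seteqP; split=> [x Hx|x [Xj Hx] i].
  by split=> [|i Hi]; apply: Hx; rewrite inE ?eqxx // Hi orbT.
by rewrite inE => /orP[/eqP->|/Hx].
Qed.

End ParametricallyDefinable.

Section ExtendedMeasure.
Variables (R : realType) (L : language) (M : structure L) (h : dim_measure R M).
Hypotheses (Hcat : omega_categorical M) (Hms : ms_measurable h).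

(* Extended to [M^0] by the convention [mu(empty tuple) = 1], so that additivity
   and Fubini need no case distinction on the lengths of tuples. *)
Definition xh n (X : set (n.-tuple M)) : nat * R := if n == 0%N then (0%N, 1) else h X.
Definition xdim n (X : set (n.-tuple M)) := (xh X).1.
Definition xmu n (X : set (n.-tuple M)) := (xh X).2.

Lemma pdefinable_in_Def n (X : set (n.-tuple M)) : (0 < n)%N -> X !=set0 ->
  pdefinable X -> in_Def X.
Proof. by move=> n0 X0 [m [e /(invariant_in_Def Hcat n0 X0)]]. Qed.

Lemma xmu_gt0 n (X : set (n.-tuple M)) : X !=set0 -> pdefinable X -> 0 < xmu X.
Proof.
case: n X => [|n] X X0 dX; rewrite /xmu /xh ?ltr01 //=.
by apply: (ms_pos Hms); apply: pdefinable_in_Def.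
Qed.

Lemma set0tuple (X : set (0.-tuple M)) : X !=set0 -> X = setT.
Proof. by case=> x Xx; apply/seteqP; split=> // y _; rewrite (tuple0 y) -(tuple0 x). Qed.

Lemma xdimU n (X Y : set (n.-tuple M)) : X !=set0 -> pdefinable X ->
  Y !=set0 -> pdefinable Y -> xdim (X `|` Y) = maxn (xdim X) (xdim Y).
Proof.
case: n X Y => [|n] X Y X0 dX Y0 dY //.
by apply: (ms_dimU Hms); apply: pdefinable_in_Def.
Qed.

Lemma xmuU_eq n (X Y : set (n.-tuple M)) : X !=set0 -> pdefinable X ->
  Y !=set0 -> pdefinable Y -> X `&` Y = set0 -> xdim X = xdim Y ->
  xmu (X `|` Y) = xmu X + xmu Y.
Proof.
case: n X Y => [|n] X Y X0 dX Y0 dY XY.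
  rewrite (set0tuple X0) (set0tuple Y0) setIT in XY.
  by have : (set0 : set (0.-tuple M)) [tuple] by rewrite -XY.
by apply: (ms_muU_eq Hms) => //; apply: pdefinable_in_Def.
Qed.

Lemma xmuU_lt n (X Y : set (n.-tuple M)) : X !=set0 -> pdefinable X ->
  Y !=set0 -> pdefinable Y -> X `&` Y = set0 -> (xdim X < xdim Y)%N ->
  xmu (X `|` Y) = xmu Y.
Proof.
case: n X Y => [|n] X Y X0 dX Y0 dY XY //.
by apply: (ms_muU_lt Hms) => //; apply: pdefinable_in_Def.
Qed.

Lemma xh_point n (a : n.-tuple M) : xh [set a] = (0%N, 1).
Proof. by case: n a => [|n] a //; apply: (ms_point Hms). Qed.

(** The family is uniformly definable without parameters, so the set of [a] at which [h] takes a
    given value is definable without parameters, hence closed under equality of types. *)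
Lemma xh_const n m (X : m.-tuple M -> set (n.-tuple M)) :
  (forall x x' a a', pel (gr x x' `|` gr a a') -> X a x -> X a' x') ->
  forall a a', pel (gr a a') -> xh (X a) = xh (X a').
Proof.
move=> HX a a' aa'; rewrite /xh; case: eqP => // /eqP; rewrite -lt0n => n0.
have [phi Hphi] : exists phi : formula L (n + m), forall z : (n + m).-tuple M,
    sat phi z <-> X (proj (@rshift n m) z) (proj (@lshift n m) z).
  apply: (invariant_formula Hcat) => z z' /pel_gr zz'; apply: HX.
  by apply: pel_sub zz' => y [|] /gr_proj.
have E b : X b = fiber phi b.
  have e1 (x : n.-tuple M) : proj (@rshift n m) [tuple of x ++ b] = b.
    by apply: eq_from_tnth => i; rewrite projE tnth_rshift.
  have e2 (x : n.-tuple M) : proj (@lshift n m) [tuple of x ++ b] = x.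
    by apply: eq_from_tnth => i; rewrite projE tnth_lshift.
  by apply/seteqP; split=> x; rewrite /fiber /= Hphi e1 e2.
have [[x Xx]|/set0P/negP/negPn/eqP Xa] := pselect (X a !=set0).
  have [psi Hpsi] := ms_definable Hms phi (h (X a)) n0.
  have /pel_gr/(_ psi)[H _] := aa'.
  have /Hpsi[_ <-] : sat psi a' by apply: H; apply/Hpsi; rewrite -E; split=> //; exists x.
  by rewrite -E.
(* Nothing is known of [h] at the empty set, so here the sets themselves are shown equal: a point of
   [X a'] would be carried back into [X a]. *)
rewrite Xa; congr h; apply/seteqP; split=> // x' Xx'.
have [x Hx] := pel_forth Hcat (fun=> iff_refl _) x' (pel_sym aa').
suff : X a x by rewrite Xa.
by apply: HX Xx'; rewrite setUC.
Qed.

Lemma xfubini_point n m (s : 'I_m -> 'I_n) (X : set (n.-tuple M)) :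
  (0 < m < n)%N -> injective s -> X !=set0 -> pdefinable X ->
  (forall x x', X x -> X x' -> proj s x = proj s x' -> x = x') ->
  h X = h (proj s @` X).
Proof.
move=> /[dup] mn /andP[m0 m_n] sinj X0 dX Xinj.
have [| a [x Xx <-]|H1 H2] := ms_fubini Hms (s := s) (X := X) (k := 0%N) (nu := 1) mn sinj.
- exact: (pdefinable_in_Def (leq_trans _ (ltnW m_n))).
- rewrite (_ : _ `&` _ = [set x]); first exact: (ms_point Hms) (leq_trans _ (ltnW m_n)).
  by apply/seteqP; split=> [y [/= xy Xy]|_ ->] //; apply: Xinj.
- by rewrite addn0 in H1; rewrite mulr1 in H2; apply: injective_projections.
Qed.

(** Fubini does not apply to [s] directly, which may repeat coordinates or lead to longer tuples.
    The graph of [proj s] on [X] projects bijectively onto [X] and onto the image, along two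
    disjoint blocks of coordinates. *)
Lemma xh_bij n m (s : 'I_m -> 'I_n) (X : set (n.-tuple M)) : X !=set0 -> pdefinable X ->
  (forall x x', X x -> X x' -> proj s x = proj s x' -> x = x') ->
  xh (proj s @` X) = xh X.
Proof.
move=> X0 dX Xinj; rewrite /xh; case: (posnP n) => n0; case: (posnP m) => m0; subst=> //.
- by case: (s (Ordinal m0)).
- case: X0 => x Xx; rewrite (_ : X = [set x]) ?(ms_point Hms) //.
  apply/seteqP; split=> [y Xy|_ ->] //; apply: Xinj => //.
  by rewrite !(tuple0 (proj s _)).
pose pl : (n + m).-tuple M -> _ := proj (@lshift n m).
pose pr : (n + m).-tuple M -> _ := proj (@rshift n m).
have el (x : n.-tuple M) (y : m.-tuple M) : pl [tuple of x ++ y] = x.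
  by apply: eq_from_tnth => i; rewrite projE tnth_lshift.
have er (x : n.-tuple M) (y : m.-tuple M) : pr [tuple of x ++ y] = y.
  by apply: eq_from_tnth => i; rewrite projE tnth_rshift.
have ext z z' : pl z = pl z' -> pr z = pr z' -> z = z'.
  move=> e1 e2; apply: eq_from_tnth => i; case: (split_ordP i) => j ->.
    by have := congr1 (fun t => tnth t j) e1; rewrite !projE.
  by have := congr1 (fun t => tnth t j) e2; rewrite !projE.
pose G : set ((n + m).-tuple M) := [set z | X (pl z) /\ proj s (pl z) = pr z].
have GX : pl @` G = X.
  apply/seteqP; split=> [_ [z [Xz _] <-]|x Xx] //; exists [tuple of x ++ proj s x]; last exact: el.
  by split; rewrite el ?er.
have GY : pr @` G = proj s @` X.
  apply/seteqP; split=> [_ [z [Xz <-] <-]|_ [x Xx <-]]; first by exists (pl z).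
  by exists [tuple of x ++ proj s x]; [split; rewrite el ?er|exact: er].
have G0 : G !=set0 by case: X0 => x; rewrite -{1}GX => -[z Gz _]; exists z.
have dG : pdefinable G.
  case: dX => k [e He]; exists k, e => z z' H [Xz pz]; split.
    by apply: He Xz; apply: pel_sub H => y [/gr_proj|]; [left|right].
  apply/(pel_proj s (x := pl z) (y := pr z)) => //.
  by apply: pel_sub H => y [] /gr_proj; left.
rewrite -GY -[in RHS]GX; transitivity (h G); [symmetry|]; apply: xfubini_point => //.
- by rewrite m0 -[X in (X < _)%N]add0n ltn_add2r.
- exact: rshift_inj.
- move=> z z' [Xz pz] [Xz' pz'] e; apply: ext => //; apply: Xinj => //.
  by rewrite pz pz'.
- by rewrite n0 -[X in (X < _)%N]addn0 ltn_add2l.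
- exact: lshift_inj.
- by move=> z z' [Xz pz] [Xz' pz'] e; apply: ext => //; rewrite -pz -pz' (_ : pl z = pl z').
Qed.

(** [ms_fubini] measures a fibre inside [M^n]; here it is measured through its coordinates [t], and
    the cases [n = 0], [m = 0] and [m = n], outside that axiom, are added. *)
Lemma xfubini n m k (s : 'I_m -> 'I_n) (t : 'I_k -> 'I_n) (X : set (n.-tuple M)) d nu :
  injective s -> X !=set0 -> pdefinable X ->
  (forall z z', X z -> X z' -> proj s z = proj s z' -> proj t z = proj t z' -> z = z') ->
  (forall a, (proj s @` X) a -> xh (proj t @` (proj s @^-1` [set a] `&` X)) = (d, nu)) ->
  xdim X = (xdim (proj s @` X) + d)%N /\ xmu X = xmu (proj s @` X) * nu.
Proof.
move=> sinj X0 dX Xst HX.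
have {}HX a : (proj s @` X) a -> xh (proj s @^-1` [set a] `&` X) = (d, nu).
  move=> Ha; rewrite -(HX a Ha) xh_bij //.
  - by case: Ha => z Xz <-; exists z.
  - by apply: pdefinableI => //; apply: pdefinable_fiber.
  - by move=> z z' [/= e Xz] [/= e' Xz']; apply: Xst; rewrite ?e ?e'.
have mn : (m <= n)%N by have := leq_card s sinj; rewrite !card_ord.
have [n0 | n0] := posnP n.
  subst n; have m0 : m = 0%N by apply/eqP; rewrite -leqn0.
  subst m; case: X0 => z Xz; have /HX : (proj s @` X) (proj s z) by exists z.
  by rewrite /xdim /xmu /xh /= => -[<- <-]; rewrite mulr1.
have [m0|m0] := posnP m.
  subst m; case: (X0) => z Xz; have /HX : (proj s @` X) (proj s z) by exists z.
  rewrite (_ : _ `&` _ = X); last first.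
    by apply/seteqP; split=> [y []|y Xy] //; split=> //=; rewrite !(tuple0 (proj s _)).
  by rewrite /xdim /xmu => -> /=; rewrite /xh /= mul1r.
move: mn; rewrite leq_eqVlt => /orP[/eqP mn|mn]; last first.
  have := ms_fubini Hms (s := s) (X := X) (k := d) (nu := nu).
  rewrite m0 mn => /(_ isT sinj (pdefinable_in_Def n0 X0 dX)) H.
  have := HX; rewrite /xdim /xmu /xh !gtn_eqF //; exact: H.
have pinj z z' : proj s z = proj s z' -> z = z' :> n.-tuple M.
  subst m; have [s' _ ss'] := injF_bij sinj => e; apply: eq_from_tnth => i.
  by have := congr1 (fun u => tnth u (s' i)) e; rewrite !projE ss'.
have E : xh (proj s @` X) = xh X by apply: xh_bij => // z z' _ _; apply: pinj.
case: (X0) => z Xz; have /HX : (proj s @` X) (proj s z) by exists z.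
rewrite (_ : _ `&` _ = [set z]).
  by rewrite xh_point /xdim /xmu E => -[<- <-]; rewrite addn0 mulr1.
by apply/seteqP; split=> [y [/= /pinj->]|_ ->].
Qed.

End ExtendedMeasure.

(** * Dimension and measure of types *)



Section TypeMeasure.
Variables (R : realType) (L : language) (M : structure L) (h : dim_measure R M).
Hypotheses (Hcat : omega_categorical M) (Hms : ms_measurable h).

Notation xh := (xh h).
Notation xdim := (xdim h).
Notation xmu := (xmu h).

Lemma pel_refl n (x : n.-tuple M) : pel (gr x x).
Proof. by apply/pel_gr. Qed.

Definition tpset n (x : n.-tuple M) : set (n.-tuple M) := [set y | eqv x y].

(* Realisations of the type of [y] over [x]. *)
Definition rtp n k (x : n.-tuple M) (y : k.-tuple M) : set (k.-tuple M) :=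
  [set y' | pel (gr x x `|` gr y y')].

Lemma rtp_self n k (x : n.-tuple M) (y : k.-tuple M) : rtp x y y.
Proof. by rewrite /rtp /= -gr_cat; apply: pel_refl. Qed.

Lemma rtp_invariant n k (x : n.-tuple M) (y : k.-tuple M) : invariant_over x (rtp x y).
Proof.
move=> y' y'' H; rewrite /rtp /= -!gr_cat => H'; apply: pel_trans H' _.
by rewrite gr_cat setUC.
Qed.

Lemma rtp_pdef n k (x : n.-tuple M) (y : k.-tuple M) : pdefinable (rtp x y).
Proof. by exists n, x; apply: rtp_invariant. Qed.

Lemma rtp_nonempty n k (x : n.-tuple M) (y : k.-tuple M) : rtp x y !=set0.
Proof. by exists y; apply: rtp_self. Qed.

Lemma tpset_pdef n (x : n.-tuple M) : pdefinable (tpset x).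
Proof.
exists 0%N, [tuple] => y y' H xy; apply: eqv_trans xy _; apply/pel_gr.
by apply: pel_sub H => z; left.
Qed.

Lemma tpset_nonempty n (x : n.-tuple M) : tpset x !=set0.
Proof. by exists x. Qed.

Lemma xh_rtp n k (x x' : n.-tuple M) (y y' : k.-tuple M) :
  pel (gr x x' `|` gr y y') -> xh (rtp x y) = xh (rtp x' y').
Proof.
move=> H; pose X (a : n.-tuple M) : set (k.-tuple M) := [set z | pel (gr x a `|` gr y z)].
have -> : rtp x' y' = X x'.
  apply/seteqP; split=> z; rewrite /X /rtp /= -!gr_cat => Hz.
    by apply: pel_trans Hz; rewrite gr_cat.
  by apply: pel_trans Hz; apply: pel_sym; rewrite gr_cat.
have -> : rtp x y = X x by [].
apply: (xh_const Hcat Hms (X := X)).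
  move=> z z' a a' Haz; rewrite /X /= -!gr_cat => Hz; apply: pel_trans Hz _.
  by rewrite gr_cat setUC.
by apply: pel_sub H => z; left.
Qed.

(** Tuples with the same entries are coordinate projections of each other. That these projections
    are mutually inverse is a property of the types, so they give a definable bijection between the
    sets of realisations. *)
Lemma xh_type n m (x : n.-tuple M) (w : m.-tuple M) : entries x = entries w ->
  xh (tpset x) = xh (tpset w).
Proof.
move=> E.
have sub k l (u : k.-tuple M) (v : l.-tuple M) : entries u `<=` entries v ->
    exists t, u = proj t v.
  move=> uv; have /choice[t Ht] : forall i, exists j, tnth v j = tnth u i.
    by move=> i; have [|j _ <-] := uv (tnth u i); [exists i|exists j].
  by exists t; apply: eq_from_tnth => i; rewrite projE Ht.
have [t xt] := sub _ _ x w (eq_ind _ (fun A => _ `<=` A) (@subset_refl _ _) _ E).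
have [t' wt] := sub _ _ w x (eq_ind _ (fun A => _ `<=` A) (@subset_refl _ _) _ (esym E)).
have fixp k (u : 'I_k -> 'I_k) (y z : k.-tuple M) : proj u y = y -> eqv y z -> proj u z = z.
  by move=> yu yz; apply/(pel_proj u (x := y) (y := y)) => //; rewrite setUid; apply/pel_gr.
have comp k l o (u : 'I_l -> 'I_k) (v : 'I_o -> 'I_l) (y : k.-tuple M) :
    proj v (proj u y) = proj (u \o v) y.
  by apply: eq_from_tnth => i; rewrite !projE.
have fx (y : n.-tuple M) : eqv x y -> proj t (proj t' y) = y.
  by rewrite comp; apply: fixp; rewrite -comp -wt.
have fw (y : m.-tuple M) : eqv w y -> proj t' (proj t y) = y.
  by rewrite comp; apply: fixp; rewrite -comp -xt.
rewrite -(xh_bij Hcat Hms (s := t) (X := tpset w)).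
- congr (xh _); apply/seteqP; split=> [y xy|_ [y wy <-]].
    by exists (proj t' y); [rewrite /tpset /= {1}wt; apply: eqv_proj|apply: fx].
  by rewrite /tpset /= {1}xt; apply: eqv_proj.
- exact: tpset_nonempty.
- exact: tpset_pdef.
- by move=> y z wy wz e; rewrite -(fw y) // e fw.
Qed.

(** The fibre of [tp(xy)] over a realisation [x'] of [tp(x)] consists of the realisations of the
    type over [x'] of a copy of [y], and all these fibres have the same value of [h]. *)
Lemma type_fubini n k (x : n.-tuple M) (y : k.-tuple M) :
  xdim (tpset [tuple of x ++ y]) = (xdim (tpset x) + xdim (rtp x y))%N /\
  xmu (tpset [tuple of x ++ y]) = xmu (tpset x) * xmu (rtp x y).
Proof.
have el (u : n.-tuple M) (v : k.-tuple M) : proj (@lshift n k) [tuple of u ++ v] = u.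
  by apply: eq_from_tnth => i; rewrite projE tnth_lshift.
have er (u : n.-tuple M) (v : k.-tuple M) : proj (@rshift n k) [tuple of u ++ v] = v.
  by apply: eq_from_tnth => i; rewrite projE tnth_rshift.
have ext (z : (n + k).-tuple M) : z = [tuple of proj (@lshift n k) z ++ proj (@rshift n k) z].
  apply: eq_from_tnth => i; case: (split_ordP i) => j ->.
    by rewrite tnth_lshift projE.
  by rewrite tnth_rshift projE.
have Eproj : proj (@lshift n k) @` tpset [tuple of x ++ y] = tpset x.
  apply/seteqP; split=> [_ [z xyz <-]|x' /pel_gr xx'].
    by rewrite /tpset /= -{1}(el x y); apply: eqv_proj.
  have [y' Hy'] := pel_forth Hcat (fun=> iff_refl _) y xx'.
  exists [tuple of x' ++ y']; last exact: el.
  by rewrite /tpset /= -pel_gr gr_cat.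
rewrite -Eproj; apply: (xfubini Hcat Hms (t := @rshift n k)).
- exact: lshift_inj.
- exact: tpset_nonempty.
- exact: tpset_pdef.
- by move=> z z' _ _ e1 e2; rewrite (ext z) e1 e2 -ext.
rewrite Eproj => x' /pel_gr xx'.
have [y' Hy'] := pel_forth Hcat (fun=> iff_refl _) y xx'.
have -> : xdim (rtp x y) = xdim (rtp x' y') by rewrite /xdim (xh_rtp Hy').
have -> : xmu (rtp x y) = xmu (rtp x' y') by rewrite /xmu (xh_rtp Hy').
have Hxy : pel (gr [tuple of x ++ y] [tuple of x' ++ y']) by rewrite gr_cat.
rewrite -surjective_pairing; congr (xh _); apply/seteqP; split=> [_ [z [/= zx' xyz] <-]|z].
  rewrite /rtp /= -gr_cat; apply: pel_trans (pel_sym Hxy) _.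
  by rewrite -zx' -ext; apply/pel_gr.
rewrite /rtp /= -gr_cat => Hz; exists [tuple of x' ++ z]; last exact: er.
split; first exact: el.
by rewrite /tpset /= -pel_gr; apply: pel_trans Hxy Hz.
Qed.

Lemma xdim_mono n (X Y : set (n.-tuple M)) : X !=set0 -> pdefinable X -> pdefinable Y ->
  X `<=` Y -> (xdim X <= xdim Y)%N.
Proof.
move=> X0 dX dY XY; have [Z0|/set0P/negP/negPn/eqP Z0] := pselect ((Y `\` X) !=set0).
  rewrite -(setDUK XY) (xdimU Hcat Hms) ?leq_maxl //.
  by rewrite setDE; apply: pdefinableI => //; apply: pdefinableC.
by rewrite -(setDUK XY) Z0 setU0.
Qed.

(* Finitely additive on the definable sets of dimension at most [D]. *)
Definition mD D n (X : set (n.-tuple M)) : R :=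
  if `[< X !=set0 /\ xdim X = D >] then xmu X else 0.

Definition small D n (X : set (n.-tuple M)) :=
  pdefinable X /\ (X !=set0 -> (xdim X <= D)%N).

Lemma mD0 D n : mD D (set0 : set (n.-tuple M)) = 0.
Proof. by rewrite /mD; case: asboolP => // -[[]]. Qed.

Lemma mD_eq D n (X : set (n.-tuple M)) : X !=set0 -> xdim X = D -> mD D X = xmu X.
Proof. by move=> X0 XD; rewrite /mD; case: asboolP => // -[]. Qed.

Lemma mD_lt D n (X : set (n.-tuple M)) : (X !=set0 -> (xdim X < D)%N) -> mD D X = 0.
Proof. by move=> XD; rewrite /mD; case: asboolP => // -[/XD + e]; rewrite e ltnn. Qed.

Lemma mD_ge0 D n (X : set (n.-tuple M)) : pdefinable X -> 0 <= mD D X.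
Proof. by rewrite /mD; case: asboolP => // -[X0 _] /(xmu_gt0 Hcat Hms X0)/ltW. Qed.

Lemma mD_neq0 D n (X : set (n.-tuple M)) : mD D X != 0 -> X !=set0 /\ xdim X = D.
Proof. by rewrite /mD; case: asboolP => //; rewrite eqxx. Qed.

Lemma small_sub D n (X Y : set (n.-tuple M)) : small D X -> pdefinable Y ->
  Y `<=` X -> small D Y.
Proof.
move=> [dX XD] dY YX; split=> // Y0; apply: leq_trans (xdim_mono Y0 dY dX YX) _.
by apply: XD; case: Y0 => y /YX; exists y.
Qed.

Lemma mDU D n (X Y : set (n.-tuple M)) : small D X -> small D Y -> X `&` Y = set0 ->
  mD D (X `|` Y) = mD D X + mD D Y.
Proof.
move=> [dX XD] [dY YD] XY.
have [X0|/set0P/negP/negPn/eqP->] := pselect (X !=set0); last by rewrite set0U mD0 add0r.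
have [Y0|/set0P/negP/negPn/eqP->] := pselect (Y !=set0); last by rewrite setU0 mD0 addr0.
have XY0 : (X `|` Y) !=set0 by case: X0 => x; exists x; left.
have dU := xdimU Hcat Hms X0 dX Y0 dY.
have := XD X0; have := YD Y0.
rewrite leq_eqVlt => /orP[/eqP YD'|YD']; rewrite leq_eqVlt => /orP[/eqP XD'|XD'].
- rewrite !mD_eq ?dU ?XD' ?YD' ?maxnn //; apply: (xmuU_eq Hcat Hms) => //.
  by rewrite XD' YD'.
- rewrite (mD_lt (X := X)) // add0r !mD_eq ?dU ?YD' //.
    by apply: (xmuU_lt Hcat Hms); rewrite ?YD'.
  by apply/maxn_idPr/ltnW.
- rewrite (mD_lt (X := Y)) // addr0 !mD_eq ?dU ?XD' //.
    by rewrite setUC; apply: (xmuU_lt Hcat Hms); rewrite ?XD' // setIC.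
  by apply/maxn_idPl/ltnW.
- by rewrite !mD_lt ?addr0 // dU gtn_max XD'.
Qed.

Lemma mD_partition D n (F : finType) (g : n.-tuple M -> F) (X : set (n.-tuple M)) :
  small D X -> (forall s, pdefinable (X `&` g @^-1` [set s])) ->
  mD D X = \sum_s mD D (X `&` g @^-1` [set s]).
Proof.
move=> XD dg.
have H (l : seq F) : uniq l -> pdefinable (X `&` [set x | g x \in l]) /\
    mD D (X `&` [set x | g x \in l]) = \sum_(s <- l) mD D (X `&` g @^-1` [set s]).
  elim: l => [_|s l IH /= /andP[sl /IH[IH1 IH2]]].
    rewrite big_nil (_ : _ `&` _ = set0); last by apply/seteqP; split=> x // [].
    by rewrite mD0; split=> //; apply: pdefinable0.
  have -> : X `&` [set x | g x \in s :: l] =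
      (X `&` g @^-1` [set s]) `|` (X `&` [set x | g x \in l]).
    apply/seteqP; split=> [x [Xx] /=|x [[Xx /= ->]|[Xx /= gl]]].
    - by rewrite inE => /orP[/eqP|]; [left|right].
    - by split=> //=; rewrite inE eqxx.
    - by split=> //=; rewrite inE gl orbT.
  split; first exact: pdefinableU.
  rewrite big_cons -IH2; apply: mDU.
  - by apply: small_sub XD _ _ => // x [].
  - by apply: small_sub XD _ _ => // x [].
  - by apply/seteqP; split=> x // [[_ /= ->] [_ /=]]; rewrite (negPf sl).
have := (H (index_enum F) (index_enum_uniq F)).2.
rewrite (_ : _ `&` _ = X) //; apply/seteqP; split=> [x []|x Xx] //; split=> //=.
exact: mem_index_enum.
Qed.

Lemma mD_le D n (X Y : set (n.-tuple M)) : small D Y -> pdefinable X -> X `<=` Y ->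
  mD D X <= mD D Y.
Proof.
move=> YD dX XY; have dYX : pdefinable (Y `\` X).
  by rewrite setDE; apply: pdefinableI; [case: YD|apply: pdefinableC].
rewrite -(setDUK XY) mDU; first by rewrite lerDl mD_ge0.
- exact: small_sub XY.
- by apply: small_sub YD dYX _ => x [].
- by apply/seteqP; split=> x // [Xx [_]].
Qed.

Lemma finitely_many_rtp n k (x : n.-tuple M) : exists (F : finType)
  (g : k.-tuple M -> F), forall y y', g y = g y' <-> rtp x y y'.
Proof.
have [F [f Hf]] := finitely_many_types Hcat (n + k).
pose P (y : k.-tuple M) i := `[< eqv (f i) [tuple of x ++ y] >].
exists {set F}, (fun y => finset (P y)) => y y'.
rewrite /rtp /= -gr_cat pel_gr; split=> [/setP H|H].
  have [i Hi] := Hf [tuple of x ++ y].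
  have := H i; rewrite !inE /P; case: asboolP => // _ /esym/asboolP Hi'.
  exact: eqv_trans (eqv_sym Hi) Hi'.
apply/setP => i; rewrite !inE /P; apply/asboolP/asboolP => Hi.
  exact: eqv_trans Hi H.
exact: eqv_trans Hi (eqv_sym H).
Qed.

(** The finitely many types over [x] inside [X] partition it, and its positive measure must be
    carried by one of full dimension. *)
Lemma exists_generic n k (x : n.-tuple M) (X : set (k.-tuple M)) : X !=set0 ->
  invariant_over x X -> exists2 y, X y & xdim (rtp x y) = xdim X.
Proof.
move=> X0 iX; have [F [g Hg]] := finitely_many_rtp k x.
have dX : pdefinable X by exists n, x.
have part y : X y -> X `&` g @^-1` [set g y] = rtp x y.
  move=> Xy; apply/seteqP; split=> [z [_ /= /esym/Hg]|z yz] //; split; last exact/esym/Hg.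
  by apply: iX Xy; rewrite setUC.
have small_X : small (xdim X) X by split.
have dg s : pdefinable (X `&` g @^-1` [set s]).
  have [[y Xy <-]|Hs] := pselect (exists2 y, X y & g y = s).
    by rewrite part //; apply: rtp_pdef.
  rewrite (_ : _ `&` _ = set0); first exact: pdefinable0.
  by apply/seteqP; split=> y // [Xy gy]; apply: Hs; exists y.
have := mD_partition small_X dg; rewrite mD_eq // => E.
have [s Hs] : exists s, mD (xdim X) (X `&` g @^-1` [set s]) != 0.
  apply: contrapT => Hn; have := xmu_gt0 Hcat Hms X0 dX; rewrite E big1 ?ltxx // => s _.
  by apply/eqP; apply: contrapT => /negP Hs; apply: Hn; exists s.
have [[y [Xy <-]] Hy] := mD_neq0 Hs; exists y => //.
by rewrite -part // Hy.
Qed.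

End TypeMeasure.

(** * Overlapping families of definable sets *)



Section Overlap.
Variables (R : realType) (L : language) (M : structure L) (h : dim_measure R M).
Hypotheses (Hcat : omega_categorical M) (Hms : ms_measurable h).

Section Pieces.
Variables (n : nat) (J : finType) (Z : J -> set (n.-tuple M)).
Hypothesis dZ : forall j, pdefinable (Z j).

Definition pieces (x : n.-tuple M) : {set J} := finset (fun j => `[< Z j x >]).

Lemma mem_pieces j x : j \in pieces x <-> Z j x.
Proof. by rewrite inE; split=> /asboolP. Qed.

Lemma pieces_pdef S : pdefinable (pieces @^-1` [set S]).
Proof.
have := pdefinable_fin (X := fun j => if j \in S then Z j else ~` Z j).
rewrite (_ : [set x | _] = pieces @^-1` [set S]).
  by apply=> j; case: ifP => _ //; apply: pdefinableC.
apply/seteqP; split=> [x Hx|x /= <- j].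
  apply/setP => j; have := Hx j; case: (boolP (j \in S)) => _ H; first exact/mem_pieces.
  by apply/negbTE/negP => Hj; apply: H; apply/mem_pieces.
case: ifP => [/mem_pieces //|/negP H Zx].
by apply: H; apply/mem_pieces.
Qed.

End Pieces.

Lemma mD_pieces D n (J : finType) (Z : J -> set (n.-tuple M)) (X : set (n.-tuple M)) :
  (forall j, pdefinable (Z j)) -> small h D X ->
  mD h D X = \sum_S mD h D (X `&` pieces Z @^-1` [set S]).
Proof.
move=> dZ sX; apply: mD_partition => // S.
by apply: pdefinableI; [case: sX|apply: pieces_pdef].
Qed.

Lemma mD_cover D n (J : finType) (Z : J -> set (n.-tuple M)) (X : set (n.-tuple M)) :
  (forall j, pdefinable (Z j)) -> small h D X -> mD h D X != 0 ->
  (forall x, X x -> exists j, Z j x) -> exists j, mD h D (X `&` Z j) != 0.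
Proof.
move=> dZ sX X0 XZ; have dX := sX.1.
have dP S : pdefinable (X `&` pieces Z @^-1` [set S]).
  by apply: pdefinableI => //; apply: pieces_pdef.
have [S HS] : exists S, mD h D (X `&` pieces Z @^-1` [set S]) != 0.
  apply: contrapT => Hn; move/negP: X0; apply; rewrite (mD_pieces dZ sX) big1 // => S _.
  by apply/eqP; apply: contrapT => /negP H; apply: Hn; exists S.
have [[x [Xx /= xS]] _] := mD_neq0 HS; have [j Zjx] := XZ x Xx; exists j.
apply/lt0r_neq0/(lt_le_trans (y := mD h D (X `&` pieces Z @^-1` [set S]))).
  by rewrite lt0r HS mD_ge0.
have dXZ := pdefinableI dX (dZ j).
apply: (mD_le Hcat Hms) => //; first by apply: (small_sub Hcat Hms sX dXZ) => y [].
move=> y [Xy /= yS]; split=> //; apply/mem_pieces; rewrite yS -xS; exact/mem_pieces.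
Qed.

(** Double counting over the atoms of the Boolean algebra generated by the [Z j]: a non-empty atom
    inside [X] lies in fewer than [k] of them. *)
Lemma overlap_bound D n K k (Z : 'I_K -> set (n.-tuple M)) (X : set (n.-tuple M)) :
  (forall j, pdefinable (Z j)) -> small h D X ->
  (forall s : {set 'I_K}, (k <= #|s|)%N -> ~ exists2 x, X x & forall j, j \in s -> Z j x) ->
  \sum_j mD h D (X `&` Z j) <= k%:R * mD h D X.
Proof.
move=> dZ sX Hk; have dX := sX.1.
pose m S := mD h D (X `&` pieces Z @^-1` [set S]).
have Ej j : mD h D (X `&` Z j) = \sum_(S : {set 'I_K}) (if j \in S then m S else 0).
  have dXZ := pdefinableI dX (dZ j).
  rewrite (mD_pieces dZ); last by apply: (small_sub Hcat Hms sX dXZ) => y [].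
  apply: eq_bigr => S _; case: (boolP (j \in S)) => jS.
    congr (mD h D _); apply/seteqP; split=> [x [[Xx Zx] /= xS]|x [Xx /= xS]] //.
    by do 2!split=> //; apply/mem_pieces; rewrite xS.
  rewrite (_ : _ `&` _ = set0) ?mD0 //; apply/seteqP; split=> // x [[Xx Zx] /= xS].
  by move/negP: jS; apply; rewrite -xS; apply/mem_pieces.
under eq_bigr do rewrite Ej.
rewrite exchange_big /= (mD_pieces dZ sX) mulr_sumr ler_sum // => S _.
rewrite -big_mkcond /= sumr_const -[m S *+ _]mulr_natl.
have [[x [Xx /= xS]]|/set0P/negP/negPn/eqP E] :=
    pselect ((X `&` pieces Z @^-1` [set S]) !=set0); last first.
  by rewrite /m E mD0 !mulr0.
rewrite ler_wpM2r //.
  by apply: (mD_ge0 Hcat Hms); apply: pdefinableI => //; apply: pieces_pdef.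
rewrite ler_nat leqNgt; apply/negP => /ltnW/Hk; apply; exists x => // j.
by rewrite -xS => /mem_pieces.
Qed.

End Overlap.

(** * Types over the entries of a tuple *)

Section TypesOverTuples.
Variables (L : language).

(** [List.In] asks for no decidable equality on the carrier, and it reduces comparisons of sets of
    entries to propositional logic. *)
Lemma entries_In (T : Type) n (x : n.-tuple T) : entries x = [set y | List.In y x].
Proof.
apply/seteqP; elim: n x => [|n IH] x.
  by split=> [y [i]|y]; [case: i|rewrite /= (tuple0 x)].
case/tupleP: x => a x; have [H1 H2] := IH x; split=> [_ [i _ <-]|y /= [<-|/H2[i _ <-]]].
- case: (unliftP ord0 i) => [j|] ->; last by rewrite tnth0; left.
  by rewrite tnthS; right; apply: H1; exists j.
- by exists ord0 => //; rewrite tnth0.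
- by exists (lift ord0 i) => //; rewrite tnthS.
Qed.

Lemma gr_diag (T : Type) n m (x : n.-tuple T) (y : m.-tuple T) :
  entries x `<=` entries y -> gr x x `<=` gr y y.
Proof. by move=> H _ [i _ <-]; have [|j _ <-] := H (tnth x i); [exists i|exists j]. Qed.

Lemma tp_eqP (M : structure L) n m (a : m.-tuple M) (x x' : n.-tuple M) :
  tp x (entries a) = tp x' (entries a) <-> pel (gr a a `|` gr x x').
Proof.
split=> [H|H].
  apply/eqv_catC => phi; split=> Hs.
    by have [] : tp x' (entries a) (PFormula phi a) by rewrite -H; split.
  by have [] : tp x (entries a) (PFormula phi a) by rewrite H; split.
have HH (psi : pformula M n) : entries (ppar psi) `<=` entries a -> psat psi x <-> psat psi x'.
  move=> Hpsi; rewrite /psat; have : eqv [tuple of x ++ ppar psi] [tuple of x' ++ ppar psi].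
    apply/pel_gr; rewrite gr_cat; apply: pel_sub H => z [?|/(gr_diag Hpsi)]; [by right|by left].
  exact.
by apply/seteqP; split=> psi [H1 H2]; split=> //; apply/HH.
Qed.

(** Several tuples are merged so that a single back-and-forth step moves them all coherently. *)
Lemma common_tuple (M : structure L) k (len : 'I_k -> nat) (v : forall i, (len i).-tuple M) :
  exists n (E : n.-tuple M) (t : forall i, 'I_(len i) -> 'I_n), forall i, proj (t i) E = v i.
Proof.
pose T : finType := {i : 'I_k & 'I_(len i)}.
exists #|T|, [tuple tnth (v (tag (enum_val j))) (tagged (enum_val j)) | j < #|T|].
exists (fun i j => enum_rank (Tagged (fun i => 'I_(len i)) j : T)) => i.
by apply: eq_from_tnth => j; rewrite projE tnth_mktuple enum_rankK.
Qed.

End TypesOverTuples.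

(** * Forking lowers the dimension *)



Section ForkingDropsDimension.
Variables (R : realType) (L : language) (M : structure L) (h : dim_measure R M).
Hypotheses (Hcat : omega_categorical M) (Hms : ms_measurable h).

Lemma elementary_equivalent (N : structure L) (f : M -> N) :
  elementary_embedding f -> elementarily_equivalent M N.
Proof. by move=> Hf phi; rewrite Hf (_ : map_tuple f _ = [tuple]) //; apply: val_inj. Qed.

Lemma entries_map (T U : Type) (f : T -> U) n (x : n.-tuple T) :
  entries (map_tuple f x) = f @` entries x.
Proof.
apply/seteqP; split=> [_ [i _ <-]|_ [_ [i _ <-] <-]].
  by exists (tnth x i); [exists i|rewrite tnth_map].
by exists i => //; rewrite tnth_map.
Qed.

Lemma gr_map (T U : Type) (f : T -> U) n m (x : n.-tuple T) (y : m.-tuple T) :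
  entries x `<=` entries y -> gr x (map_tuple f x) `<=` gr y (map_tuple f y).
Proof.
move=> H _ [i _ <-]; have [|j _ E] := H (tnth x i); first by exists i.
by exists j => //; rewrite !tnth_map E.
Qed.

Lemma gr_proj_sub (T U : structure L) n m (s : 'I_m -> 'I_n) (x : n.-tuple T)
    (y : n.-tuple U) x' y' : proj s x = x' -> proj s y = y' -> gr x' y' `<=` gr x y.
Proof. by move=> <- <-; apply: gr_proj. Qed.

(* If [phi(x,e)] had full dimension in [tp(c/a)], so would all its conjugates
   [phi(x,d_j)]; large finite families of these would then be too big in
   measure for their intersections of size [k] to be empty. *)
Lemma divides_drop (N : structure L) (f : M -> N) p r (a : p.-tuple M) (c : r.-tuple M)
    (phi : pformula N r) (e : (plen phi).-tuple M) :
  elementary_embedding f ->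
  pel (gr a (map_tuple f a) `|` gr e (ppar phi)) ->
  divides phi (f @` entries a) ->
  mD h (xdim h (rtp a c)) (rtp a c `&` psat (PFormula (pform phi) e)) = 0.
Proof.
move=> Hf He [k' [d [Hd Hinc]]]; have MN := elementary_equivalent Hf.
set D := xdim h (rtp a c); set X := rtp a c.
apply: contrapT => /eqP nu0.
have sX : small h D X by split=> //; apply: rtp_pdef.
have dphi l (e' : l.-tuple M) (ph : formula L (r + l)) : pdefinable (psat (PFormula ph e')).
  by exists l, e'; apply: psat_invariant (PFormula ph e').
have nu_gt0 : 0 < mD h D (X `&` psat (PFormula (pform phi) e)).
  rewrite lt0r nu0 (mD_ge0 Hcat Hms) //.
  by apply: pdefinableI; [apply: rtp_pdef|apply: dphi].
set nu := mD h D _ in nu0 nu_gt0.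
(* Enough conjugates for their total measure to exceed the bound of [overlap_bound]. *)
have [K HK] : exists K : nat, k'%:R * mD h D X < K%:R * nu.
  exists (Num.bound (k'%:R * mD h D X / nu)); rewrite -ltr_pdivrMr //.
  apply: archi_boundP; apply: divr_ge0; last exact: ltW.
  by apply: mulr_ge0 => //; apply: (mD_ge0 Hcat Hms); apply: rtp_pdef.
(* Only the first [K] terms of the dividing sequence are used; they are copied into [M] over [a]. *)
have [n [E [t Ht]]] := common_tuple (fun j : 'I_K => d j).
have afa : pel (gr a (map_tuple f a)) by apply: pel_sub He => z; left.
have [E' HE'] := pel_back Hcat MN E afa.
pose d' j := proj (t j) E'.
pose Z j := psat (PFormula (pform phi) (d' j)).
have conj j : pel (gr a a `|` gr e (d' j)).
  have E1 : pel (gr (map_tuple f a) (map_tuple f a) `|` gr (ppar phi) (d j)).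
    by apply/tp_eqP; rewrite entries_map Hd.
  have E2 : pel (gr a (map_tuple f a) `|` gr (d' j) (d j)).
    by apply: pel_sub HE' => z [?|Hz]; [left|right; exact: gr_proj_sub (erefl _) (Ht j) _ Hz].
  rewrite -!gr_cat in He E1 E2 *.
  exact: pel_trans (pel_trans He E1) (pel_sym E2).
have EZ j : mD h D (X `&` Z j) = nu.
  pose Y (w : (p + plen phi).-tuple M) : set (r.-tuple M) :=
    [set x | pel (gr a (proj (@lshift p (plen phi)) w) `|` gr c x) /\
             psat (PFormula (pform phi) (proj (@rshift p (plen phi)) w)) x].
  have YE w : X `&` psat (PFormula (pform phi) w) = Y [tuple of a ++ w].
    have -> : Y [tuple of a ++ w] = [set x | rtp a c x /\ psat (PFormula (pform phi) w) x].
      rewrite /Y /rtp (_ : proj _ _ = a); last first.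
        by apply: eq_from_tnth => i; rewrite projE tnth_lshift.
      rewrite (_ : proj _ _ = w) //.
      by apply: eq_from_tnth => i; rewrite projE tnth_rshift.
    by [].
  have := xh_const Hcat Hms (X := Y) _ (a := [tuple of a ++ e]) (a' := [tuple of a ++ d' j]).
  rewrite gr_cat -!YE => H.
  have {}H : xh h (X `&` Z j) = xh h (X `&` psat (PFormula (pform phi) e)).
    symmetry; apply: H => // x x' w w' Hw [H1 H2]; split.
      move: H1; rewrite -!gr_cat => H1; apply: (pel_trans H1); rewrite gr_cat.
      by apply: pel_sub Hw => z [/gr_proj|]; [right|left].
    move: H2; rewrite /psat /=; set u := [tuple of x ++ _]; set u' := [tuple of x' ++ _].
    have /pel_gr -> // : pel (gr u u').
    by rewrite gr_cat; apply: pel_sub Hw => z [|/gr_proj]; [left|right].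
  have [[x [Xx Ex]] Dx] := mD_neq0 nu0.
  have : (X `&` Z j) !=set0.
    have [x' Hx'] := pel_forth Hcat (fun=> iff_refl _) x (x := [tuple of a ++ e])
       (y := [tuple of a ++ d' j]) ltac:(by rewrite gr_cat; apply: conj).
    exists x'; split.
      move: Xx; rewrite /X /rtp /= -!gr_cat => Xx; apply: (pel_trans Xx); rewrite gr_cat.
      by rewrite gr_cat in Hx'; apply: pel_sub Hx' => z [?|?]; [left; left|right].
    move: Ex; rewrite /Z /psat /=; set u := [tuple of x ++ _]; set u' := [tuple of x' ++ _].
    have /pel_gr -> // : pel (gr u u').
    by rewrite gr_cat; rewrite gr_cat in Hx'; apply: pel_sub Hx' => z [?|?]; [right|left; right].
  by move=> XZ0; rewrite mD_eq // /nu ?mD_eq //; [rewrite /xmu H|exists x|rewrite /xdim H].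
have := @overlap_bound R L M h Hcat Hms D r K k' Z X (fun j => dphi _ _ _) sX.
under eq_bigr do rewrite EZ.
rewrite sumr_const card_ord -[nu *+ _]mulr_natl leNgt HK => Hov.
apply: (negP (Hov _)) => // s Hs [x Xx Zx].
(* A point common to [k'] of the copies moves forward to [N], where it satisfies [k'] formulas of
   the dividing sequence. *)
rewrite -gr_cat in HE'; have [x' Hx'] := pel_forth Hcat MN x HE'.
apply: (Hinc (map val (take k' (enum s)))).
- by rewrite map_inj_uniq ?take_uniq ?enum_uniq //; apply: val_inj.
- by rewrite size_map size_takel // -cardE.
exists x' => i /mapP[j /mem_take]; rewrite mem_enum => /Zx Zj ->.
move: Zj; rewrite /Z /psat /=; set u := [tuple of x ++ _]; set u' := [tuple of x' ++ _].
have /pel_gr -> // : pel (gr u u').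
rewrite gr_cat; rewrite gr_cat in Hx'; apply: pel_sub Hx' => z [?|Hz]; [by right|left; right].
exact: gr_proj_sub (erefl _) (Ht j) _ Hz.
Qed.

(** Without a drop, the realisations of [tp(c/ab)] have positive measure in dimension [d(c/a)], so
    one of the finitely many dividing formulas that cover them has full dimension in [tp(c/a)]. *)
Lemma forks_drop p q r (a : p.-tuple M) (b : q.-tuple M) (c : r.-tuple M) :
  forks (tp c (entries [tuple of a ++ b])) (entries a) ->
  (xdim h (rtp [tuple of a ++ b] c) < xdim h (rtp a c))%N.
Proof.
move=> [N [f [Hf [k [phi [Hdiv [j [psi [Hpsi Hcov]]]]]]]]].
have MN := elementary_equivalent Hf.
set ab := [tuple of a ++ b]; set D := xdim h (rtp a c); set Y := rtp ab c.
have YX : Y `<=` rtp a c.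
  by move=> x; apply: pel_sub => z [H|?]; [left; rewrite gr_cat; left|right].
rewrite ltn_neqAle; apply/andP; split; last first.
  apply: (xdim_mono Hcat Hms) => //; [exact: rtp_nonempty|exact: rtp_pdef|exact: rtp_pdef].
apply/eqP => YD.
have [n [E [t Ht]]] := common_tuple (fun i => ppar (phi i)).
have ff m (x : m.-tuple M) : pel (gr x (map_tuple f x)) by apply/pel_gr.
(* The parameters are copied over [ab], not only over [a], so that the copied formulas still cover
   the realisations of [tp(c/ab)]. *)
have [E' HE'] := pel_back Hcat MN E (ff _ ab).
pose e i := proj (t i) E'.
have He i : pel (gr a (map_tuple f a) `|` gr (e i) (ppar (phi i))).
  apply: pel_sub HE' => z [Hz|Hz]; last by right; exact: gr_proj_sub (erefl _) (Ht i) _ Hz.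
  left; apply: gr_map Hz => _ [l _ <-]; exists (lshift q l) => //.
  by rewrite tnth_lshift.
pose Z i := psat (PFormula (pform (phi i)) (e i)).
have dZ i : pdefinable (Z i).
  by exists (plen (phi i)), (e i); apply: psat_invariant (PFormula (pform (phi i)) (e i)).
have sY : small h D Y by split; [apply: rtp_pdef|rewrite YD].
have Y0 : mD h D Y != 0.
  rewrite mD_eq //; last exact: rtp_nonempty.
  by apply: lt0r_neq0; apply: (xmu_gt0 Hcat Hms); [apply: rtp_nonempty|apply: rtp_pdef].
have YZ x : Y x -> exists i, Z i x.
  move=> Yx; rewrite -gr_cat in HE'; have [x' Hx'] := pel_forth Hcat MN x HE'.
  rewrite gr_cat in Hx'.
  have [i|i Hi] := Hcov x'.
    have [Hsub Hs] := Hpsi i.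
    suff /pel_gr H : pel (gr [tuple of c ++ ppar (psi i)]
      [tuple of x' ++ map_tuple f (ppar (psi i))]) by apply/H/Hs.
    apply: (pel_trans (y := [tuple of x ++ ppar (psi i)])).
      rewrite gr_cat; apply: pel_sub Yx => z [?|]; [by right|move=> Hz; left].
      exact: gr_diag Hz.
    rewrite gr_cat; apply: pel_sub Hx' => z [?|Hz]; [by right|left; left].
    exact: gr_map Hz.
  exists i; move: Hi; rewrite /Z /psat /=; set u := [tuple of x' ++ _]; set u' := [tuple of x ++ _].
  have /pel_gr H : pel (gr u' u).
    rewrite gr_cat; apply: pel_sub Hx' => z [?|]; [by right|move=> Hz; left; right].
    exact: gr_proj_sub (erefl _) (Ht i) _ Hz.
  by move/H.
have [i /negP[]] := mD_cover Hcat Hms dZ sY Y0 YZ.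
have sX : small h D (rtp a c) by split=> //; apply: rtp_pdef.
have dXZ : pdefinable (rtp a c `&` Z i) by apply: pdefinableI => //; apply: rtp_pdef.
have dYZ : pdefinable (Y `&` Z i) by apply: pdefinableI => //; apply: rtp_pdef.
rewrite eq_le (mD_ge0 Hcat Hms) // andbT.
apply: le_trans (mD_le Hcat Hms (Y := rtp a c `&` Z i) _ dYZ _) _.
- by apply: (small_sub Hcat Hms sX dXZ) => x [].
- by move=> x [/YX].
- by rewrite (divides_drop c Hf (He i) (Hdiv i)).
Qed.

End ForkingDropsDimension.

(** * A drop of dimension implies forking *)



Section DimensionDropForks.
Variables (R : realType) (L : language) (M : structure L) (h : dim_measure R M).
Hypotheses (Hcat : omega_categorical M) (Hms : ms_measurable h).

(** Dimension of a finite set of points; sequences keep lengths out of the types when tuples are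
    concatenated and permuted. *)
Definition sdim (s : seq M) := xdim h (tpset (in_tuple s)).

Lemma sdim_eq s s' : (forall z, List.In z s <-> List.In z s') -> sdim s = sdim s'.
Proof.
move=> H; rewrite /sdim /xdim (xh_type Hcat Hms (w := in_tuple s')) //.
by rewrite !entries_In; apply/seteqP; split=> z /H.
Qed.

Lemma sdim_tuple n (x : n.-tuple M) : xdim h (tpset x) = sdim x.
Proof. by rewrite /sdim /xdim (xh_type Hcat Hms (w := in_tuple x)) // !entries_In. Qed.

Lemma sdim_cat k s (y : k.-tuple M) : sdim (s ++ y) = (sdim s + xdim h (rtp (in_tuple s) y))%N.
Proof. by rewrite -(type_fubini Hcat Hms (in_tuple s) y).1 sdim_tuple. Qed.

Lemma sdim_mono s s' : (forall z, List.In z s -> List.In z s') -> (sdim s <= sdim s')%N.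
Proof.
move=> H; have -> : sdim s' = sdim (s ++ in_tuple s').
  by apply: sdim_eq => z; rewrite List.in_app_iff; split=> [|[/H|]] //; right.
by rewrite sdim_cat leq_addr.
Qed.

Lemma rtp_mono n m k (x : n.-tuple M) (x' : m.-tuple M) (y : k.-tuple M) :
  entries x `<=` entries x' -> (xdim h (rtp x' y) <= xdim h (rtp x y))%N.
Proof.
move=> xx'; apply: (xdim_mono Hcat Hms); [exact: rtp_nonempty|exact: rtp_pdef|exact: rtp_pdef|].
by move=> z; apply: pel_sub => w [/(gr_diag xx')|]; [left|right].
Qed.

(** Each term is a generic point of the set of realisations of [tp(b/a)], seen as definable over [a]
    and all earlier terms. *)
Lemma independent_sequence p q (a : p.-tuple M) (b : q.-tuple M) :
  exists d : nat -> q.-tuple M, forall i, rtp a b (d i) /\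
    xdim h (rtp (in_tuple (a ++ flatten [seq tval (d j) | j <- iota 0 i])) (d i))
      = xdim h (rtp a b).
Proof.
have /choice[f Hf] : forall l : seq (q.-tuple M), exists y, rtp a b y /\
    xdim h (rtp (in_tuple (a ++ flatten [seq tval z | z <- l])) y) = xdim h (rtp a b).
  move=> l; set s := a ++ _.
  have as_ : entries a `<=` entries (in_tuple s).
    by rewrite !entries_In => z Hz; apply/List.in_app_iff; left.
  have [|y aby Hy] := exists_generic Hcat Hms (x := in_tuple s) (rtp_nonempty a b).
    move=> y y' H; apply: rtp_invariant; apply: pel_sub H => z [?|Hz]; [by left|right].
    exact: gr_diag Hz.
  by exists y.
pose l := fix l i := if i is j.+1 then rcons (l j) (f (l j)) else [::].
exists (fun i => f (l i)) => i.
suff -> : [seq tval (f (l j)) | j <- iota 0 i] = [seq tval z | z <- l i] by apply: Hf.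
elim: i => // i IH; rewrite -addn1 iotaD map_cat IH /= add0n addn1 /=.
by rewrite map_rcons cats1.
Qed.

Lemma drop_forks p q r (a : p.-tuple M) (b : q.-tuple M) (c : r.-tuple M) :
  (xdim h (rtp [tuple of a ++ b] c) < xdim h (rtp a c))%N ->
  forks (tp c (entries [tuple of a ++ b])) (entries a).
Proof.
move=> drop; have [d Hd] := independent_sequence a b.
pose B (l : seq nat) := flatten [seq tval (d j) | j <- l].
have BS l i : B (rcons l i) = B l ++ d i by rewrite /B map_rcons flatten_rcons.
(* Symmetry: computing [d(abc)] in two orders gives [d(b/a) + d(c/ab) = d(c/a) + d(b/ac)]. *)
have dropb : (xdim h (rtp [tuple of a ++ c] b) < xdim h (rtp a b))%N.
  have E1 := (type_fubini Hcat Hms [tuple of a ++ b] c).1.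
  have E2 := (type_fubini Hcat Hms [tuple of a ++ c] b).1.
  rewrite (type_fubini Hcat Hms a b).1 in E1; rewrite (type_fubini Hcat Hms a c).1 in E2.
  have E : xdim h (tpset [tuple of [tuple of a ++ b] ++ c]) =
           xdim h (tpset [tuple of [tuple of a ++ c] ++ b]).
    rewrite !sdim_tuple; apply: sdim_eq => z /=.
    rewrite !List.in_app_iff; tauto.
  rewrite E1 E2 -!addnA in E; move/addnI: E => E.
  by rewrite -(ltn_add2l (xdim h (rtp a c))) -E addnC ltn_add2r.
have [phi Hphi] := invariant_fiber Hcat (@rtp_invariant L M _ _ [tuple of a ++ b] c).
pose Phi := PFormula phi [tuple of a ++ b].
have HPhi x : psat Phi x <-> rtp [tuple of a ++ b] c x by rewrite Hphi.
exists M, id; split.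
  move=> n psi v; rewrite (_ : map_tuple id v = v) //.
  by apply: val_inj; rewrite /= map_id.
exists 1%N, (fun=> Phi); split; last first.
  exists 1%N, (fun=> Phi); split=> [_|x Hx].
    by split=> //; apply/HPhi; apply: rtp_self.
  exists ord0; have := Hx ord0; rewrite /psat /=.
  set u := [tuple of _]; set u' := [tuple of _].
  by suff -> : u = u' by []; apply: val_inj; rewrite /= map_id.
move=> _; exists (xdim h (rtp a c)).+1, (fun i => [tuple of a ++ d i]).
rewrite image_id; split=> [i|s us ss [x Hx]].
  apply/tp_eqP => /=; have := (Hd i).1; rewrite /rtp /= -gr_cat => H.
  rewrite gr_cat; apply: pel_sub (pel_sym H) => z.
  rewrite gr_cat => -[?|[?|?]]; rewrite ?gr_cat; [by left|by left|by right].
have Hxi i : i \in s -> pel (gr a a `|` gr b (d i) `|` gr c x).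
  move=> /Hx Hs; have := (Hd i).1; rewrite /rtp /= -gr_cat => abd.
  have [x0 Hx0] := pel_back Hcat (fun=> iff_refl _) x abd.
  have : rtp [tuple of a ++ b] c x0.
    apply/HPhi.
    suff /pel_gr/(_ phi)[_ E] : pel (gr [tuple of x0 ++ [tuple of a ++ b]]
        [tuple of x ++ [tuple of a ++ d i]]) by exact: E Hs.
    by rewrite gr_cat setUC.
  rewrite /rtp /= -!gr_cat => H; rewrite -gr_cat in Hx0; exact: pel_trans H Hx0.
have Hac i : i \in s -> pel (gr a a `|` gr c x).
  by move=> /Hxi; apply: pel_sub => z [?|?]; [left; left|right].
have upper l : {subset l <= s} ->
    (sdim ((a ++ x) ++ B l) <= sdim (a ++ x) + size l * xdim h (rtp [tuple of a ++ c] b))%N.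
  elim/last_ind: l => [|l i IH] Hl; first by rewrite /B /= cats0 mul0n addn0.
  have is_ : i \in s by apply: Hl; rewrite mem_rcons inE eqxx.
  rewrite BS catA sdim_cat size_rcons mulSn addnCA [X in (_ <= X)%N]addnC.
  apply: leq_add; first by apply: IH => j jl; apply: Hl; rewrite mem_rcons inE jl orbT.
  have -> : xdim h (rtp [tuple of a ++ c] b) = xdim h (rtp [tuple of a ++ x] (d i)).
    rewrite /xdim (xh_rtp Hcat Hms (x' := [tuple of a ++ x]) (y' := d i)) //.
    rewrite gr_cat; apply: pel_sub (Hxi _ is_) => z [[?|?]|?]; [left; left|right|left; right] => //.
  apply: rtp_mono; rewrite !entries_In => z /= Hz.
  by apply/List.in_app_iff; left.
have lower l : sorted ltn l ->
    (sdim a + size l * xdim h (rtp a b) <= sdim (a ++ B l))%N.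
  elim/last_ind: l => [|l i IH] Hl; first by rewrite /B /= cats0 mul0n addn0.
  have [sl li] : sorted ltn l /\ all (fun j => j < i)%N l.
    move: Hl; rewrite !(sorted_pairwise ltn_trans) -cats1 pairwise_cat allrel1r.
    by move=> /and3P[].
  rewrite BS catA sdim_cat size_rcons mulSn addnCA addnC.
  apply: leq_add; first exact: IH.
  rewrite -(Hd i).2; apply: rtp_mono; rewrite !entries_In => z /= /List.in_app_iff[Hz|Hz].
    by apply/List.in_app_iff; left.
  apply/List.in_app_iff; right.
  elim: l li Hz {Hl IH sl} => //= j l IH /andP[ji li]; rewrite List.in_app_iff.
  case=> [Hz|]; last exact: IH.
  have : j \in iota 0 i by rewrite mem_iota.
  elim: (iota 0 i) => //= j' l' IH'; rewrite inE => /orP[/eqP<-|/IH' H];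
    apply/List.in_app_iff; [by left|by right].
(* Independence is relative to the earlier terms, whereas the distinct indices in [s] come in any
   order. *)
pose l := sort leq s.
have ls : {subset l <= s} by move=> i; rewrite mem_sort.
have sl : sorted ltn l by rewrite ltn_sorted_uniq_leq sort_uniq us sort_sorted //; apply: leq_total.
have i0 : nth 0%N s 0 \in s by apply: mem_nth; rewrite ss.
have Eax : sdim (a ++ x) = (sdim a + xdim h (rtp a c))%N.
  have -> : xdim h (rtp a c) = xdim h (rtp a x) by rewrite /xdim (xh_rtp Hcat Hms (Hac _ i0)).
  by rewrite -[LHS]/(sdim [tuple of a ++ x]) -sdim_tuple (type_fubini Hcat Hms a x).1 sdim_tuple.
have mono : (sdim (a ++ B l) <= sdim ((a ++ x) ++ B l))%N.
  by apply: sdim_mono => z; rewrite !List.in_app_iff; tauto.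
(* This amounts to [k d(b/a) <= d(c/a) + k d(b/ac)], which the drop [d(b/ac) < d(b/a)] makes
   impossible for [k = d(c/a) + 1]. *)
have := leq_trans (lower l sl) (leq_trans mono (upper l ls)).
rewrite Eax size_sort ss -addnA leq_add2l leqNgt => /negP; apply.
apply: leq_trans (_ : _ <= (xdim h (rtp a c)).+1 * (xdim h (rtp [tuple of a ++ c] b)).+1)%N _.
  by rewrite mulnS addSn ltnS.
by rewrite leq_mul2l dropb orbT.
Qed.

End DimensionDropForks.

(** * Non-forking extensions *)



Section NonforkingExtensions.
Variables (R : realType) (L : language) (M : structure L) (h : dim_measure R M).
Hypotheses (Hcat : omega_categorical M) (Hms : ms_measurable h).

Lemma tuple_muE m (x : m.-tuple M) : tuple_mu h x = xmu h (tpset x).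
Proof.
rewrite /tuple_mu /xmu /xh; case: eqP => // _; rewrite /dm_mu.
have [chi0 [chi0x Hchi0]] := isolating_formula Hcat x.
case: xgetP => [chi _ [chix Hchi]|/(_ chi0)[]]; last first.
  by split=> // psi Hpsi y Hy; apply/(Hchi0 y Hy psi).1.
suff -> : sat chi = tpset x by [].
apply/seteqP; split=> y Hy; last exact/Hy.
move=> psi; split=> [H|H]; first exact: Hchi H _ Hy.
by apply: contrapT => Hn; apply: (Hchi (FNot psi)) Hy H.
Qed.

Lemma dim_rtp_le p q r (a : p.-tuple M) (b : q.-tuple M) (c c' : r.-tuple M) :
  rtp a c c' -> (xdim h (rtp [tuple of a ++ b] c') <= xdim h (rtp a c))%N.
Proof.
move=> cc'; rewrite [X in (_ <= X)%N]/xdim (xh_rtp Hcat Hms cc').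
apply: (rtp_mono Hcat Hms) => _ [i _ <-]; exists (lshift q i) => //.
by rewrite tnth_lshift.
Qed.

(** Applied to negations as well, the inclusion of [tp(c/a)] gives equality of types over [a]; the
    rest is the equivalence of forking with a drop of dimension. *)
Lemma nonforking_extensionP p q r (a : p.-tuple M) (b : q.-tuple M) (c c' : r.-tuple M) :
  nonforking_extension (tp c (entries a)) (tp c' (entries [tuple of a ++ b]))
    (entries a) (entries [tuple of a ++ b]) <->
  rtp a c c' /\ xdim h (rtp [tuple of a ++ b] c') = xdim h (rtp a c).
Proof.
have dE : rtp a c c' -> xdim h (rtp a c) = xdim h (rtp a c').
  by move=> cc'; rewrite /xdim (xh_rtp Hcat Hms cc').
have aab : entries a `<=` entries [tuple of a ++ b].
  by move=> _ [i _ <-]; exists (lshift q i) => //; rewrite tnth_lshift.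
split=> [[_ sub nf]|[cc' dcc']].
  have cc' : rtp a c c'.
    apply/eqv_catC => psi.
    have H (phi : formula L (r + p)) : sat phi [tuple of c ++ a] -> sat phi [tuple of c' ++ a].
      by move=> Hs; have [] := sub (PFormula phi a) (conj (@subset_refl _ _) Hs).
    split=> [|Hs]; first exact: H.
    by apply: contrapT => Hn; apply: (H (FNot psi)) Hs.
  split=> //; apply/eqP; rewrite eqn_leq dim_rtp_le //= leqNgt; apply/negP => Hlt.
  by apply: nf; apply: (drop_forks Hcat Hms); rewrite -dE.
split.
- split=> [phi []//|k psi Hpsi|phi Hphi].
    by exists c' => i; case: (Hpsi i).
  by have [H|H] := pselect (psat phi c'); [left|right].
- move=> psi [H1 H2]; split; first exact: subset_trans aab.
  have := (tp_eqP a c c').2 cc' => /(congr1 (fun A : set _ => A psi)).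
  by move=> E; have : tp c' (entries a) psi; [rewrite -E|case].
- by move/(forks_drop Hcat Hms); rewrite dcc' dE // ltnn.
Qed.

(** The realisations of [tp(c/a)] outside the listed types form a set [W] definable over [ab]. If
    [W] had full dimension, its generic point would realise a non-forking extension absent from the
    list; so [W] is negligible. *)
Lemma sum_nonforking_extensions p q r (a : p.-tuple M) (b : q.-tuple M) (c : r.-tuple M)
    n (cs : 'I_n -> r.-tuple M) :
  lists_nonforking_extensions c (entries a) (entries [tuple of a ++ b]) cs ->
  xmu h (rtp a c) = \sum_(i < n) xmu h (rtp [tuple of a ++ b] (cs i)).
Proof.
move=> [csinj Hcs]; set ab := [tuple of a ++ b].
set X := rtp a c; set D := xdim h X.
have sX : small h D X by split=> //; apply: rtp_pdef.
have Hi i : rtp a c (cs i) /\ xdim h (rtp ab (cs i)) = D.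
  by apply/nonforking_extensionP/Hcs; exists i.
have Xi i y : rtp ab (cs i) y -> X y.
  move=> Hy; have := (Hi i).1; rewrite /X /rtp /= -!gr_cat => H; apply: (pel_trans H).
  by rewrite gr_cat; apply: pel_sub Hy => z [?|?]; [left; rewrite gr_cat; left|right].
have cs_eq i j y : rtp ab (cs i) y -> rtp ab (cs j) y -> i = j.
  move=> Hy Hy'; apply: csinj.
  by move/tp_eqP: Hy => ->; move/tp_eqP: Hy' => ->.
pose g (y : r.-tuple M) := [pick i | `[< rtp ab (cs i) y >]].
have gS i : X `&` g @^-1` [set Some i] = rtp ab (cs i).
  apply/seteqP; split=> [y [Xy]|y Hy].
    by rewrite /g /=; case: pickP => // j /asboolP Hj [<-].
  split; first exact: Xi Hy.
  rewrite /g /=; case: pickP => [j /asboolP Hj|/(_ i)/asboolP//].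
  by rewrite (cs_eq _ _ _ Hj Hy).
set W := X `&` g @^-1` [set None].
have WE y : W y <-> X y /\ forall i, ~ rtp ab (cs i) y.
  split=> -[Xy Hy]; split=> //.
    by move=> i; move: Hy; rewrite /g /=; case: pickP => // Hn _ Hi'; have /asboolP := Hn i.
  by rewrite /= /g; case: pickP => // i /asboolP /Hy.
have iW : invariant_over ab W.
  move=> y y' H /WE[Xy Hy]; apply/WE; split=> [|i Hi'].
    apply: rtp_invariant Xy; apply: pel_sub H => z [?|?]; [by left|right].
    by rewrite gr_cat; left.
  apply: (Hy i); apply: rtp_invariant Hi'; rewrite -gr_cat.
  by apply: pel_sym; rewrite gr_cat.
have W0 : mD h D W = 0.
  apply: mD_lt => Wne; have [y /WE[Xy Hy] <-] := exists_generic Hcat Hms Wne iW.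
  rewrite ltn_neqAle dim_rtp_le // andbT; apply/eqP => dy.
  have /Hcs[i Ei] : nonforking_extension (tp c (entries a)) (tp y (entries ab))
      (entries a) (entries ab).
    exact/nonforking_extensionP.
  by apply: (Hy i); apply/tp_eqP.
have -> : xmu h X = mD h D X by rewrite mD_eq //; apply: rtp_nonempty.
rewrite (mD_partition Hcat Hms (g := g)) //; last first.
  case=> [i|]; first by rewrite gS; apply: rtp_pdef.
  by exists (p + q)%N, ab.
rewrite (bigD1 None) //= W0 add0r (reindex_omap Some id) /=; last by case.
by apply: eq_big => [i|i _]; rewrite ?eqxx // gS mD_eq ?(Hi i).2 //; apply: rtp_nonempty.
Qed.

End NonforkingExtensions.

Theorem corollary2p20 (R : realType) (L : language) (M : structure L)
    (h : dim_measure R M)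
    (Hcat : omega_categorical M) (Hms : ms_measurable h)
    (p q r : nat) (a : p.-tuple M) (b : q.-tuple M) (c : r.-tuple M)
    (n : nat) (cs : 'I_n -> r.-tuple M)
    (Hcs : lists_nonforking_extensions c (entries a)
             (entries [tuple of a ++ b]) cs) :
  tuple_mu h [tuple of a ++ c] * tuple_mu h [tuple of a ++ b] / tuple_mu h a
  = \sum_(i < n) tuple_mu h [tuple of a ++ b ++ cs i].
Proof.
(* The two bracketings of the concatenation have different tuple types; [xh_type] identifies their
   measures through their entries. *)
have mu_cat i : tuple_mu h [tuple of a ++ b ++ cs i] =
    tuple_mu h [tuple of a ++ b] * xmu h (rtp [tuple of a ++ b] (cs i)).
  rewrite !(tuple_muE h Hcat) -(type_fubini Hcat Hms [tuple of a ++ b] (cs i)).2.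
  rewrite /xmu (xh_type Hcat Hms (w := [tuple of [tuple of a ++ b] ++ cs i])) //.
  by rewrite !entries_In /= catA.
under eq_bigr do rewrite mu_cat.
rewrite -mulr_sumr -(sum_nonforking_extensions Hcat Hms Hcs).
rewrite [tuple_mu h [tuple of a ++ c]](tuple_muE h Hcat) (type_fubini Hcat Hms a c).2 -(tuple_muE h Hcat).
have a0 : tuple_mu h a != 0.
  rewrite (tuple_muE h Hcat); apply/lt0r_neq0/(xmu_gt0 Hcat Hms); first exact: tpset_nonempty.
  exact: tpset_pdef.
by rewrite mulrC !mulrA mulVf // mul1r mulrC.
Qed.
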